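(* Let $c_1,c_2\in\mathbb R$ and $p\in(0,1)$, $p\ne7/8$, be such that $\lambda^{(2)}_p(\Gamma^{(p)})<-\frac12<\lambda^{(1)}_p(\Gamma^{(p)})<0$ almost surely. Then there exists a finite random variable $L^{(p)}_{c_1,c_2}$ such that $$\frac{\big(c_1\nu^{(1)}_p(\Gamma^{(p)})+c_2\nu^{(2)}_p(\Gamma^{(p)})\big)^\top(\Gamma_n-\Gamma^{(p)})}{n^{\lambda^{(1)}_p(\Gamma^{(p)})}}\xrightarrow{\text{a.s.}}L^{(p)}_{c_1,c_2}.$$
   Context: A random variable is $\mathrm{Rad}(q)$ if it equals $+1$ with probability $q$ and $-1$ with probability $1-q$. Random walk with two memory channels with parameter $p\in(0,1)$: $S_0=0$; $X_1,X_2$ i.i.d. $\mathrm{Rad}(1/2)$; for $n\ge 2$, $U_{1,n+1},U_{2,n+1}$ i.i.d. uniform on $\{1,\dots,n\}$ and $\alpha_{1,n+1},\alpha_{2,n+1}$ i.i.d. $\mathrm{Rad}(p)$, all mutually independent and independent of $X_1,\dots,X_n$ (and earlier draws); $T_{n+1}=\alpha_{1,n+1}X_{U_{1,n+1}}+\alpha_{2,n+1}X_{U_{2,n+1}}$, $X_{n+1}=\max(-1,\min(1,T_{n+1}))$. $S_n^{\pm}$ = number of $\pm1$ steps among $X_1,\dots,X_n$, $\Gamma_n=(S_n^+/n,S_n^-/n)^\top$; for $p\ne7/8$, $\Gamma^{(p)}$ is the almost sure limit of $\Gamma_n$. $h_p(x)=\big(((1-p)x_1+px_2-1)^2-(1-x_1-x_2)^2-x_1,\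 ((1-p)x_2+px_1-1)^2-(1-x_1-x_2)^2-x_2\big)^\top$ on $[0,1]^2$, $J_p(x)$ its Jacobian; $\lambda^{(1)}_p(x)\ge\lambda^{(2)}_p(x)$ are the eigenvalues of $J_p(x)$, $\nu^{(i)}_p(x)$ corresponding eigenvectors with first coordinate $1$ (at $(1/3,1/3)^\top$: for $p\le1/2$, $\nu^{(1)}=(1,1)^\top,\nu^{(2)}=(1,-1)^\top$; for $1/2<p<7/8$ reversed). *)

(* Defs.v *)
From HB Require Import structures.
From mathcomp Require Import all_boot all_order all_algebra.
From mathcomp Require Import all_classical all_reals all_analysis.
Set Implicit Arguments. Unset Strict Implicit. Unset Printing Implicit Defensive.
Import Order.TTheory GRing.Theory Num.Theory.
Import numFieldNormedType.Exports.
Local Open Scope classical_set_scope.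
Local Open Scope ring_scope.

Section TwoChannels.
Variable R : realType.

Definition vec2 (a b : R) : 'cV[R]_2 :=
  \col_(i < 2) (if i == ord0 then a else b).

Definition Pr d (T : measurableType d) (P : probability T R) (E : set T) : R :=
  fine (P E).

Definition is_Rad d (T : measurableType d) (P : probability T R) (q : R)
  (Y : T -> R) : Prop :=
  measurable_fun setT Y /\
  P (Y @^-1` [set 1]) = q%:E /\ P (Y @^-1` [set -1]) = (1 - q)%:E.

Definition is_unif d (T : measurableType d) (P : probability T R) (n : nat)
  (V : T -> nat) : Prop :=
  (forall j, measurable (V @^-1` [set j])) /\
  (forall j, (1 <= j <= n)%N -> P (V @^-1` [set j]) = (n%:R^-1)%:E).

(* Mutual independence of the family X_1, X_2, (U_{i,k}, alpha_{i,k})_{i<2, k>=3}: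
   product rule over every finite subfamily (unused members get the full set). *)
Definition family_indep d (T : measurableType d) (P : probability T R)
  (X : nat -> T -> R) (U : 'I_2 -> nat -> T -> nat) (A : 'I_2 -> nat -> T -> R) :
  Prop :=
  forall (m : nat) (B1 B2 : set R) (BU : 'I_2 -> nat -> set nat)
         (BA : 'I_2 -> nat -> set R),
    measurable B1 -> measurable B2 -> (forall i k, measurable (BA i k)) ->
    Pr P (X 1%N @^-1` B1 `&` X 2%N @^-1` B2 `&`
          \bigcap_(k in [set k | (3 <= k <= m)%N])
            \bigcap_(i in [set: 'I_2])
              (U i k @^-1` BU i k `&` A i k @^-1` BA i k))
    = Pr P (X 1%N @^-1` B1) * Pr P (X 2%N @^-1` B2) *
      \prod_(3 <= k < m.+1) \prod_(i < 2)
         (Pr P (U i k @^-1` BU i k) * Pr P (A i k @^-1` BA i k)).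

(* The random walk with two memory channels with parameter p.
   X n is the n-th step (n >= 1), U i k = U_{i+1,k}, A i k = alpha_{i+1,k}. *)
Definition two_channel_walk d (T : measurableType d) (P : probability T R)
  (p : R) (X : nat -> T -> R) (U : 'I_2 -> nat -> T -> nat)
  (A : 'I_2 -> nat -> T -> R) : Prop :=
  [/\ is_Rad P (1/2) (X 1%N) /\ is_Rad P (1/2) (X 2%N),
      (forall i n, (2 <= n)%N -> is_unif P n (U i n.+1)),
      (forall i n, (2 <= n)%N -> is_Rad P p (A i n.+1)),
      family_indep P X U A &
      (forall n w, (2 <= n)%N ->
         X n.+1 w = Num.max (-1) (Num.min 1
           (A ord0 n.+1 w * X (U ord0 n.+1 w) w
            + A (lift ord0 ord0) n.+1 w * X (U (lift ord0 ord0) n.+1 w) w)))].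

Definition Splus (X : nat -> R) (n : nat) : R :=
  \sum_(1 <= k < n.+1) ((X k == 1)%:R : R).
Definition Sminus (X : nat -> R) (n : nat) : R :=
  \sum_(1 <= k < n.+1) ((X k == -1)%:R : R).
Definition Gam (X : nat -> R) (n : nat) : 'cV[R]_2 :=
  vec2 (Splus X n / n%:R) (Sminus X n / n%:R).

Definition h1 (p x1 x2 : R) : R :=
  ((1 - p) * x1 + p * x2 - 1) ^+ 2 - (1 - x1 - x2) ^+ 2 - x1.
Definition h2 (p x1 x2 : R) : R :=
  ((1 - p) * x2 + p * x1 - 1) ^+ 2 - (1 - x1 - x2) ^+ 2 - x2.
Definition hcomp (p : R) (i : 'I_2) : R -> R -> R :=
  if i == ord0 then h1 p else h2 p.

Definition Jp (p : R) (x : 'cV[R]_2) : 'M[R]_2 :=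
  \matrix_(i < 2, j < 2)
    (if j == ord0 then derive1 (fun t => hcomp p i t (x 1%R 0)) (x 0 0)
     else derive1 (fun t => hcomp p i (x 0 0) t) (x 1%R 0)).

Definition lam1 (p : R) (x : 'cV[R]_2) : R :=
  xget 0 [set l | eigenvalue (Jp p x) l /\
                  forall l', eigenvalue (Jp p x) l' -> l' <= l].
Definition lam2 (p : R) (x : 'cV[R]_2) : R :=
  xget 0 [set l | eigenvalue (Jp p x) l /\
                  forall l', eigenvalue (Jp p x) l' -> l <= l'].

Definition nu (p : R) (x : 'cV[R]_2) (l : R) : 'cV[R]_2 :=
  vec2 1 (xget 0 [set v | Jp p x *m vec2 1 v = l *: vec2 1 v]).
Definition nu1 p x := nu p x (lam1 p x).
Definition nu2 p x := nu p x (lam2 p x).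

End TwoChannels.

(* Main.v *)
(* Let M_n be the compensated number of +1 (resp. -1) steps.  Its increments are
   bounded martingale differences, so Azuma's exponential moment bound and
   Borel-Cantelli give |M_n| <= 4 sqrt(n) ln n eventually, almost surely; from
   there on the argument is pathwise.  With z_n = Gamma_n - M_n / n one has
   z_{n+1} - z_n = (h(Gamma_n) + M_n / n) / (n + 1), so h vanishes at the limit G
   by Cesaro.  Pairing z_n - G with the left eigenvectors of the Jacobian
   decouples the recursion up to errors O(n^(-b) + |z_n - G|^2), for any b < 1/2.
   Taking -lambda1 < b < 1/2, a first pass gives |z_n - G| = O(n^(3 lambda1 / 4)),
   whose square is o(n^lambda1) with a polynomial gain; a second pass shows that
   n^(-lambda1) times the first coordinate has summable increments, while the
   second coordinate is o(n^lambda1).  Since M_n / n = o(n^lambda1) as well, every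
   linear functional of Gamma_n - G converges after division by n^lambda1.
   The limit is measurable because h has only finitely many zeros. *)
Require Import Defs.
From HB Require Import structures.
From mathcomp Require Import all_boot all_order all_algebra.
From mathcomp Require Import all_classical all_reals all_analysis.
From mathcomp Require Import measurable_realfun.
From mathcomp Require Import zify ring lra.
Import Order.TTheory GRing.Theory Num.Theory.
Import numFieldNormedType.Exports.
Local Open Scope classical_set_scope.
Local Open Scope ring_scope.

(** * Perturbed linear recursions with step size [1 / n] *)

(** No filtration or conditional expectation is built on the probability space. Histories are words
    over [option bool], [walk_mean] is an iterated finite sum over them, and the exponential moment
    bound is a statement about that sum. The bridge to [P] is the inequality [Pr_history_le]: union
    bounds suffice, and irregular draws are discarded with a null set. The noise is subtracted
    before rescaling because increments of size [O(1/n)], multiplied by [n^(-lambda1)], are not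
    absolutely summable; only after this subtraction does a comparison with summable increments
    apply. The condition [lambda1 > -1/2] is what leaves room for an exponent [b] strictly between
    [-lambda1] and [1/2]. In the first pass, the factor 3/4 has to exceed 1/2, so that the square
    beats [n^lambda1], and to stay below 1, so that some contraction is left over to absorb the
    quadratic error. Measurability is delicate because [lam1], [nu1], [nu2] are picked by [xget] and
    [G] is an arbitrary map. The limit is therefore assembled from functionals taken at the fixed
    points in [drift_zeros]. *)

Lemma powR_succ_Bernoulli (R : realType) (n : nat) (s : R) : (0 < n)%N -> s <= 0 ->
  n.+1%:R `^ s * (1 - s / n.+1%:R) <= n%:R `^ s.
Proof.
move=> n0 s0.
have n0' : 0 < n%:R :> R by rewrite ltr0n.
have m0 : 0 < n.+1%:R :> R by rewrite ltr0n.
have -> : n%:R `^ s = n.+1%:R `^ s * (n%:R / n.+1%:R) `^ s.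
  rewrite -powRM ?ler0n ?divr_ge0 ?ler0n //.
  by rewrite mulrCA mulfV ?mulr1 // gt_eqF.
rewrite ler_pM2l ?powR_gt0 //.
rewrite /powR gt_eqF ?divr_gt0 //.
apply: le_trans (expR_ge1Dx _); rewrite lerD2l.
have -> : n%:R / n.+1%:R = 1 + (- n.+1%:R^-1) :> R.
  by rewrite -(addn1 n) natrD; field; rewrite -natr1 in m0; rewrite gt_eqF.
rewrite -mulrN; apply: ler_wnM2l => //.
apply: le_ln1Dx; rewrite ltrN2 invf_lt1 // ltr1n ltnS //.
Qed.

(** This is [powR_succ_Bernoulli] for the exponent [r - 1 <= 0], multiplied by [n]: the product of
    [1 - 1/(n+1)] and [1 + (1-r)/(n+1)] is the stated factor exactly. *)
Lemma powR_succ_ge (R : realType) (n : nat) (r : R) : (0 < n)%N -> 0 < r < 1 ->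
  n.+1%:R `^ r * (1 - r / n.+1%:R - (1 - r) / n.+1%:R ^+ 2) <= n%:R `^ r.
Proof.
move=> n0 /andP[r0 r1].
have n0' : 0 < n%:R :> R by rewrite ltr0n.
have m0 : 0 < n.+1%:R :> R by rewrite ltr0n.
have := @powR_succ_Bernoulli R n (r - 1) n0.
rewrite subr_le0 (ltW r1) => /(_ isT).
rewrite -(ler_pM2l n0').
have E (k : nat) : (0 < k)%N -> k%:R `^ r = k%:R * k%:R `^ (r - 1) :> R.
  move=> k0; have k0' : k%:R != 0 :> R by rewrite pnatr_eq0 -lt0n.
  rewrite -[X in X * _]powRr1 ?ler0n // -powRD; first by congr (_ `^ _); ring.
  by rewrite k0' implybT.
rewrite -E // (E n.+1) //; apply: le_trans.
rewrite le_eqVlt; apply/orP; left; apply/eqP.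
move: m0; rewrite -(addn1 n) natrD => m0.
by field; rewrite gt_eqF.
Qed.

(** Bernoulli for the exponent [-r] gives [n^r (1 + u) <= (n+1)^r] with [u = r/(n+1)]. Multiplying
    by [1 - u + u^2] suffices, since [(1 + u)(1 - u + u^2) = 1 + u^3 >= 1]. *)
Lemma powR_succ_le (R : realType) (n : nat) (r : R) : (0 < n)%N -> 0 < r < 1 ->
  n%:R `^ r <= n.+1%:R `^ r * (1 - r / n.+1%:R + r ^+ 2 / n.+1%:R ^+ 2).
Proof.
move=> n0 /andP[r0 r1].
have n0' : 0 < n%:R :> R by rewrite ltr0n.
have m0 : 0 < n.+1%:R :> R by rewrite ltr0n.
have := @powR_succ_Bernoulli R n (- r) n0.
rewrite oppr_le0 (ltW r0) => /(_ isT).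
rewrite !powRN.
set x := n%:R `^ r; set y := n.+1%:R `^ r.
have x0 : 0 < x by rewrite powR_gt0.
have y0 : 0 < y by rewrite powR_gt0.
set t := n.+1%:R^-1 : R.
have t0 : 0 < t by rewrite invr_gt0.
rewrite mulNr opprK -/t => H.
have H2 : x * (1 + r * t) <= y.
  have := ler_wpM2l (ltW (mulr_gt0 x0 y0)) H.
  have -> : x * y * (y^-1 * (1 + r * t)) = x * (1 + r * t).
    by field; rewrite gt_eqF.
  by have -> : x * y / x = y by field; rewrite gt_eqF.
have -> : r ^+ 2 / n.+1%:R ^+ 2 = (r * t) ^+ 2 by rewrite exprMn exprVn.
have u0 : 0 < r * t by exact: mulr_gt0.
rewrite -/t.
move: u0 H2; set u := r * t => u0 H2.
have w0 : 0 <= 1 - u + u ^+ 2 by nra.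
apply: le_trans (ler_wpM2r w0 H2).
have -> : x * (1 + u) * (1 - u + u ^+ 2) = x + x * u ^+ 3 by ring.
by rewrite lerDl mulr_ge0 ?exprn_ge0 // ltW.
Qed.

(* The increment bound telescopes against [tau^-1 * n^(-tau)]. *)
Lemma eventually_bounded_summable_increments (R : realType) (tau C : R) (x : nat -> R) :
  0 < tau -> 0 <= C ->
  (\forall n \near \oo, x n.+1 <= x n + C * n.+1%:R `^ (- tau) / n.+1%:R) ->
  exists K, \forall n \near \oo, x n <= K.
Proof.
move=> tau0 C0 [N _ HN].
pose y n := x n + C / tau * n%:R `^ (- tau).
have ymono n : (maxn N 1 <= n)%N -> y n.+1 <= y n.
  rewrite geq_max => /andP[Nn n0].
  have := HN _ Nn; rewrite /y.
  have := @powR_succ_Bernoulli R n (- tau) n0.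
  rewrite oppr_le0 (ltW tau0) => /(_ isT) H1 H2.
  have Ct : 0 <= C / tau by rewrite divr_ge0 // ltW.
  have := ler_wpM2l Ct H1.
  set a := n.+1%:R `^ _ in H1 H2 *; set b := n%:R `^ _ in H1 *.
  have -> : C / tau * (a * (1 - (- tau) / n.+1%:R)) = C / tau * a + C * a / n.+1%:R.
    by field; rewrite gt_eqF //=; rewrite gt_eqF // ltr0n.
  set t := C * a / _ in H2 *; set u := C / tau * a; set v := C / tau * b => H3.
  apply: (@le_trans _ _ (x n + t + u)); first by rewrite lerD2r.
  by rewrite -addrA lerD2l addrC.
exists (y (maxn N 1)); exists (maxn N 1) => // n /= Hn.
have : y n <= y (maxn N 1).
  rewrite -(subnKC Hn); elim: (n - maxn N 1)%N => [|k IH]; first by rewrite addn0.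
  by rewrite addnS; apply: le_trans IH; apply: ymono; rewrite leq_addr.
apply: le_trans; rewrite /y lerDl.
by rewrite mulr_ge0 ?powR_ge0 // divr_ge0 // ltW.
Qed.

(** The increments are dominated by those of [e n = (C/tau) n^(-tau)]. Hence [e] and [x + e] are
    both eventually nonincreasing and bounded below, and [x] is the difference of two convergent
    sequences. *)
Lemma cvgn_summable_increments (R : realType) (tau C : R) (x : nat -> R) :
  0 < tau -> 0 <= C ->
  (\forall n \near \oo, `|x n.+1 - x n| <= C * n.+1%:R `^ (- tau) / n.+1%:R) ->
  cvgn x.
Proof.
move=> tau0 C0 H.
pose e n := C / tau * n%:R `^ (- tau).
have [e0 He] : (forall n, 0 <= e n) /\
    \forall n \near \oo, C * n.+1%:R `^ (- tau) / n.+1%:R <= e n - e n.+1.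
  split=> [n|]; first by rewrite mulr_ge0 ?powR_ge0 // divr_ge0 // ltW.
  exists 1%N => // n /= n0; rewrite /e.
  have := @powR_succ_Bernoulli R n (- tau) n0.
  rewrite oppr_le0 (ltW tau0) => /(_ isT) H1.
  have Ct : 0 <= C / tau by rewrite divr_ge0 // ltW.
  have := ler_wpM2l Ct H1.
  set a := n.+1%:R `^ _ in H1 *; set b := n%:R `^ _ in H1 *.
  have -> : C / tau * (a * (1 - (- tau) / n.+1%:R)) = C / tau * a + C * a / n.+1%:R.
    by field; rewrite gt_eqF //=; rewrite gt_eqF // ltr0n.
  by rewrite lerBrDl.
have [N _ HN] : \forall n \near \oo, `|x n.+1 - x n| <= e n - e n.+1.
  near=> n; apply: (@le_trans _ _ (C * n.+1%:R `^ (- tau) / n.+1%:R)); near: n; exact.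
have bound k : `|x (k + N)%N - x N| <= e N - e (k + N)%N.
  elim: k => [|k IH]; first by rewrite add0n !subrr normr0.
  have := HN (k + N)%N; rewrite /= leq_addl => /(_ isT) H1.
  rewrite addSn; have -> : x (k + N).+1 - x N = (x (k + N).+1 - x (k + N)%N) + (x (k + N)%N - x N) by ring.
  apply: le_trans (ler_normD _ _) _; lra.
have cve : cvgn (fun k => e (k + N)%N).
  apply: nonincreasing_is_cvgn.
  - apply/nonincreasing_seqP => k.
    have := HN (k + N)%N; rewrite /= leq_addl => /(_ isT) H1.
    by rewrite -subr_ge0; apply: le_trans H1.
  - by exists 0 => _ [k _ <-].
have cvu : cvgn (fun k => x (k + N)%N + e (k + N)%N).
  apply: nonincreasing_is_cvgn.
  - apply/nonincreasing_seqP => k.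
    have := HN (k + N)%N; rewrite /= leq_addl => /(_ isT).
    rewrite ler_norml addSn => /andP[_]; lra.
  - exists (x N - e N) => _ [k _ <-].
    have := bound k; have := e0 (k + N)%N; rewrite ler_norml => ? /andP[]; lra.
have : cvgn (fun k => x (k + N)%N).
  have -> : (fun k => x (k + N)%N) = (fun k => (x (k + N)%N + e (k + N)%N) - e (k + N)%N).
    by apply/funext => k; ring.
  exact: is_cvgB.
by move=> /cvg_ex[l Hl]; apply/cvg_ex; exists l; move: Hl; rewrite (cvg_shiftn N).
Unshelve. all: by end_near.
Qed.

(** After multiplication by [n^r], the gap [r < s] absorbs the second-order term of [powR_succ_ge]
    as soon as [n+1 >= (1-r)/(s-r)]. What remains is an increment bound with exponent
    [tau - r > 0]. *)
Lemma decay_of_contraction (R : realType) (r s tau C : R) (d : nat -> R) :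
  0 < r < 1 -> r < s -> r < tau -> 0 <= C -> (forall n, 0 <= d n) ->
  (\forall n \near \oo,
     d n.+1 <= (1 - s / n.+1%:R) * d n + C * n.+1%:R `^ (- tau) / n.+1%:R) ->
  exists K, \forall n \near \oo, d n <= K * n%:R `^ (- r).
Proof.
move=> r01 rs rtau C0 d0 H.
have [K HK] : exists K, \forall n \near \oo, n%:R `^ r * d n <= K.
  apply: (@eventually_bounded_summable_increments R (tau - r) C) => //.
    by rewrite subr_gt0.
  near=> n.
  have n0 : (0 < n)%N by near: n; exists 1%N.
  have m0 : 0 < n.+1%:R :> R by rewrite ltr0n.
  have : d n.+1 <= (1 - s / n.+1%:R) * d n + C * n.+1%:R `^ (- tau) / n.+1%:R.
    by near: n.
  have /(ler_wpM2r (d0 n)) := @powR_succ_ge R n r n0 r01.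
  have Em : n.+1%:R `^ (- (tau - r)) = n.+1%:R `^ r * n.+1%:R `^ (- tau) :> R.
    by rewrite opprB -powRD // (gt_eqF m0) implybT.
  rewrite Em.
  set m := n.+1%:R; set A := m `^ r; set B := m `^ (- tau) => H1 H2.
  have A0 : 0 < A by rewrite powR_gt0.
  have := ler_wpM2l (ltW A0) H2.
  have : (1 - s / m) <= 1 - r / m - (1 - r) / m ^+ 2.
    suff : (1 - r) / m <= s - r.
      move=> Hm; have := ler_wpM2r (ltW (_ : 0 < m^-1)) Hm.
      rewrite invr_gt0 => /(_ m0); rewrite expr2 invfM; move: (m^-1) => t; nra.
    rewrite ler_pdivrMr //.
    have : (1 - r) / (s - r) <= m.
      by rewrite /m -natr1; apply: (@le_trans _ _ n%:R); [near: n; exact: nbhs_infty_ger|rewrite lerDl].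
    by rewrite ler_pdivrMr ?subr_gt0 // mulrC.
  move=> /(ler_wpM2r (d0 n))/(ler_wpM2l (ltW A0)) H3 H4.
  apply: le_trans H4 _; rewrite mulrDr !mulrA; apply: lerD; last first.
    by rewrite le_eqVlt; apply/orP; left; apply/eqP; ring.
  by rewrite -!mulrA in H3 H1 *; apply: le_trans H3 _.
exists K; near=> n.
have n0 : (0 < n)%N by near: n; exists 1%N.
rewrite powRN ler_pdivlMr ?powR_gt0 ?ltr0n // mulrC.
by near: n.
Unshelve. all: by end_near.
Qed.

(** Here the rescaling exponent equals the contraction rate, so no slack is left and both expansions
    of [n^s] are needed: [n^s] and [(n+1)^s (1 - s/(n+1))] differ by [O(n^(s-2))]. Against a bounded
    [c] this is summable because [s < 1]. *)
Lemma cvgn_rescaled_contraction (R : realType) (s tau C D : R) (c : nat -> R) :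
  0 < s < 1 -> s < tau -> 0 <= C -> 
  (\forall n \near \oo, `|c n| <= D) ->
  (\forall n \near \oo,
     `|c n.+1 - (1 - s / n.+1%:R) * c n| <= C * n.+1%:R `^ (- tau) / n.+1%:R) ->
  cvgn (fun n => n%:R `^ s * c n).
Proof.
move=> s01 stau C0 cD H.
have /andP[s0 s1] := s01.
have D0 : 0 <= D.
  have [N _ HN] := cD; by apply: le_trans (HN N _) => /=.
apply: (@cvgn_summable_increments R (Num.min (tau - s) (1 - s)) (C + D)).
- by rewrite lt_min !subr_gt0 stau.
- exact: addr_ge0.
near=> n.
have n0 : (0 < n)%N by near: n; exists 1%N.
have m0 : 0 < n.+1%:R :> R by rewrite ltr0n.
have cn : `|c n| <= D by near: n.
have Hn : `|c n.+1 - (1 - s / n.+1%:R) * c n| <= C * n.+1%:R `^ (- tau) / n.+1%:R.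
  by near: n.
have L := @powR_succ_ge R n s n0 s01.
have U := @powR_succ_le R n s n0 s01.
set q := Num.min _ _.
have E1 : n.+1%:R `^ s * n.+1%:R `^ (- tau) <= n.+1%:R `^ (- q) :> R.
  rewrite -powRD ?(gt_eqF m0) ?implybT //; apply: ler_powR; first by rewrite ler1n.
  have : q <= tau - s by rewrite ge_min lexx.
  lra.
have E2 : n.+1%:R `^ s * n.+1%:R^-1 <= n.+1%:R `^ (- q) :> R.
  rewrite -powR_inv1 ?ler0n // -powRD ?(gt_eqF m0) ?implybT //.
  apply: ler_powR; first by rewrite ler1n.
  have : q <= 1 - s by rewrite ge_min lexx orbT.
  lra.
move: L U Hn E1 E2; set m := n.+1%:R; set A := m `^ s; set B := n%:R `^ s.
set Q := m `^ (- q); set W := m `^ (- tau).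
rewrite expr2 invfM => L U Hn E1 E2.
have A0 : 0 < A by rewrite powR_gt0.
have -> : A * c n.+1 - B * c n =
  A * (c n.+1 - (1 - s / m) * c n) + (A * (1 - s / m) - B) * c n by ring.
apply: le_trans (ler_normD _ _) _; rewrite !normrM (gtr0_norm A0).
have -> : (C + D) * Q / m = C * (Q / m) + D * (Q / m) by ring.
apply: lerD.
  apply: le_trans (ler_wpM2l (ltW A0) Hn) _.
  rewrite [leLHS](_ : _ = C * (A * W / m)); last by ring.
  by rewrite ler_wpM2l // ler_wpM2r // invr_ge0 ltW.
rewrite mulrC; apply: ler_pM => //.
set t := m^-1; have t0 : 0 < t by rewrite invr_gt0.
have E3 : A * t * t <= Q * t by apply: ler_wpM2r => //; exact: ltW.
have Att : 0 < A * t * t by rewrite !mulr_gt0.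
rewrite -/t in L U.
have L' : A * (1 - s * t) - B <= (1 - s) * (A * t * t).
  rewrite lerBlDr -lerBlDl; apply: le_trans L.
  by rewrite le_eqVlt; apply/orP; left; apply/eqP; ring.
have U' : B - A * (1 - s * t) <= s ^+ 2 * (A * t * t).
  rewrite lerBlDr; apply: le_trans U _.
  by rewrite le_eqVlt; apply/orP; left; apply/eqP; ring.
have s2 : s ^+ 2 <= 1 by rewrite expr_le1 // ltW.
have s2' := ler_wpM2r (ltW Att) s2.
have s3 : 0 <= s * (A * t * t) by rewrite mulr_ge0 // ltW.
rewrite ler_norml; apply/andP; split; lra.
Unshelve. all: by end_near.
Qed.

Lemma cvgn_powRN (R : realType) (x : R) : 0 < x -> (fun n => n%:R `^ (- x)) @ \oo --> (0 : R).
Proof.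
move=> x0; apply/cvgr0Pnorm_le => e e0.
near=> n.
have n0 : 0 < n%:R :> R by rewrite ltr0n; near: n; exists 1%N.
rewrite ger0_norm ?powR_ge0 // powRN -[e]invrK lef_pV2 ?posrE ?invr_gt0 ?powR_gt0 //.
rewrite -[leLHS](_ : (e^-1 `^ x^-1) `^ x = _); last first.
  by rewrite -powRrM mulVf ?gt_eqF // powRr1 // invr_ge0 ltW.
apply: ge0_ler_powR; rewrite ?nnegrE ?powR_ge0 ?ler0n ?ltW //.
by near: n; exact: nbhs_infty_gtr.
Unshelve. all: by end_near.
Qed.

Lemma powRN_succ_le (R : realType) (n : nat) (x : R) : (0 < n)%N -> 0 <= x ->
  n%:R `^ (- x) <= 2 `^ x * n.+1%:R `^ (- x).
Proof.
move=> n0 x0.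
have n0' : 0 < n%:R :> R by rewrite ltr0n.
have m0 : 0 < n.+1%:R :> R by rewrite ltr0n.
rewrite !powRN ler_pdivlMr ?powR_gt0 // ler_pdivrMl ?powR_gt0 //.
rewrite -powRM ?ler0n // ge0_ler_powR ?nnegrE ?mulr_ge0 ?ler0n //.
by rewrite -natrM ler_nat; lia.
Qed.

Lemma planar_contraction (R : realType) (r mu b C : R) (x y : nat -> R) :
  0 < r < 1 -> r < b -> r < mu -> 0 <= C ->
  x @ \oo --> (0 : R) -> y @ \oo --> (0 : R) ->
  (\forall n \near \oo, `|x n.+1 - (1 - r / n.+1%:R) * x n| <=
     C * (n.+1%:R `^ (- b) + (`|x n| + `|y n|) ^+ 2) / n.+1%:R) ->
  (\forall n \near \oo, `|y n.+1 - (1 - mu / n.+1%:R) * y n| <=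
     C * (n.+1%:R `^ (- b) + (`|x n| + `|y n|) ^+ 2) / n.+1%:R) ->
  cvgn (fun n => n%:R `^ r * x n) /\ (fun n => n%:R `^ r * y n) @ \oo --> (0 : R).
Proof.
move=> r01 rb rmu C0 x0 y0 Hx Hy.
have /andP[r0 r1] := r01.
pose N n := `|x n| + `|y n|.
have N0 n : 0 <= N n by exact: addr_ge0.
have Ncvg : N @ \oo --> (0 : R).
  by rewrite -[0]addr0 -[X in X + _](@normr0 _ R^o) -[X in _ + X](@normr0 _ R^o); apply: cvgD; exact: cvg_norm.
have Nsm e : 0 < e -> \forall n \near \oo, N n <= e.
  move=> e0; near=> n; rewrite -[leLHS]ger0_norm //; near: n.
  exact: cvgr0_norm_le.
have smallV (c : R) : \forall n \near \oo, c / n.+1%:R <= 1.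
  near=> n; rewrite ler_pdivrMr ?ltr0n // mul1r.
  apply: (@le_trans _ _ n%:R); last by rewrite ler_nat.
  by near: n; exact: nbhs_infty_ger.
have contr (c : R) (z : nat -> R) : 0 <= c ->
    (\forall n \near \oo, `|z n.+1 - (1 - c / n.+1%:R) * z n| <=
     C * (n.+1%:R `^ (- b) + (N n) ^+ 2) / n.+1%:R) ->
    (\forall n \near \oo, `|z n.+1| <= (1 - c / n.+1%:R) * `|z n| +
     C * (n.+1%:R `^ (- b) + (N n) ^+ 2) / n.+1%:R).
  move=> c0 Hz; near=> n.
  have -> : z n.+1 = (1 - c / n.+1%:R) * z n + (z n.+1 - (1 - c / n.+1%:R) * z n) by ring.
  apply: le_trans (ler_normD _ _) _; apply: lerD; last by near: n.
  by rewrite normrM ger0_norm // subr_ge0; near: n; exact: smallV.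
have mu0 : 0 < mu by exact: lt_trans rmu.
have cx := contr r x (ltW r0) Hx.
have cy := contr mu y (ltW mu0) Hy.
(* First pass. Once [N] is small, the quadratic error [2 C N^2] is at most [(r/8) N], which lowers
   the contraction rate from [r] to [7r/8]; the decay rate [3r/4] lies strictly below it. The square
   of this bound has rate [3r/2 > r], whence [tau]. *)
have [K HK] : exists K, \forall n \near \oo, N n <= K * n%:R `^ (- (3 / 4 * r)).
  apply: (@decay_of_contraction R (3 / 4 * r) (7 / 8 * r) b (2 * C)) => //; try lra.
  near=> n.
  have m0 : 0 < n.+1%:R :> R by rewrite ltr0n.
  have Nsmall : 2 * C * N n <= r / 8.
    have C1 : 0 < 2 * C + 1 by lra.
    have : N n <= r / 8 / (2 * C + 1).
      near: n; apply: Nsm; rewrite divr_gt0 //; lra.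
    by rewrite ler_pdivlMr // => H; have := N0 n; nra.
  have Hx1 : `|x n.+1| <= (1 - r / n.+1%:R) * `|x n| +
     C * (n.+1%:R `^ (- b) + (N n) ^+ 2) / n.+1%:R by near: n.
  have Hy1 : `|y n.+1| <= (1 - mu / n.+1%:R) * `|y n| +
     C * (n.+1%:R `^ (- b) + (N n) ^+ 2) / n.+1%:R by near: n.
  move: m0 Hx1 Hy1; rewrite -invr_gt0.
  have := N0 n; move: Nsmall.
  rewrite (_ : N n.+1 = `|x n.+1| + `|y n.+1|) //.
  have : `|y n| >= 0 by []. have : `|x n| >= 0 by [].
  have EN : N n = `|x n| + `|y n| by []. 
  move: EN.
  move: (N n) (n.+1%:R `^ (- b)) (n.+1%:R^-1) `|x n| `|y n| `|x n.+1| `|y n.+1|.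
  move=> Nn B t xn yn xn1 yn1 EN xn0 yn0 NS Nn0 t0 Hx1 Hy1.
  have h1 : (mu - r) * t * yn >= 0 by rewrite !mulr_ge0 ?subr_ge0 // ltW.
  have h2 : (2 * C * Nn) * (Nn * t) <= (r / 8) * (Nn * t).
    by apply: ler_wpM2r => //; rewrite mulr_ge0 // ltW.
  have -> : (1 - 7 / 8 * r * t) * Nn + 2 * C * B * t =
    ((1 - r * t) * xn + C * (B + Nn ^+ 2) * t) +
    ((1 - mu * t) * yn + C * (B + Nn ^+ 2) * t) +
    (mu - r) * t * yn + ((r / 8) * (Nn * t) - (2 * C * Nn) * (Nn * t)).
    by rewrite EN; field.
  lra.
pose tau := Num.min b (3 / 2 * r).
have rtau : r < tau by rewrite lt_min rb /=; lra.
pose C' := C * (1 + K ^+ 2 * 2 `^ (3 / 2 * r)).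
have C'0 : 0 <= C' by rewrite mulr_ge0 // addr_ge0 // mulr_ge0 ?sqr_ge0 ?powR_ge0.
have err : \forall n \near \oo, C * (n.+1%:R `^ (- b) + (N n) ^+ 2) / n.+1%:R <=
    C' * n.+1%:R `^ (- tau) / n.+1%:R.
  near=> n.
  have n0 : (0 < n)%N by near: n; exists 1%N.
  apply: ler_wpM2r; first by rewrite invr_ge0.
  rewrite /C' -[leRHS]mulrA; apply: ler_wpM2l => //; rewrite mulrDl mul1r.
  apply: lerD.
    by apply: ler_powR; rewrite ?ler1n // lerN2 ge_min lexx.
  have HN : N n <= K * n%:R `^ (- (3 / 4 * r)) by near: n.
  have : N n ^+ 2 <= (K * n%:R `^ (- (3 / 4 * r))) ^+ 2.
    by rewrite ler_pXn2r // nnegrE //; apply: le_trans HN.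
  move/le_trans; apply; rewrite exprMn -[leRHS]mulrA ler_wpM2l ?sqr_ge0 //.
  rewrite expr2 -powRD; last by rewrite pnatr_eq0 -lt0n n0 implybT.
  rewrite (_ : - _ - _ = - (3 / 2 * r)); last by field.
  apply: le_trans (@powRN_succ_le R n _ n0 _) _; first by lra.
  rewrite ler_wpM2l ?powR_ge0 // ler_powR ?ler1n // lerN2.
  by rewrite ge_min lexx orbT.
have contr' z (c : R) : (\forall n \near \oo, `|z n.+1 - (1 - c / n.+1%:R) * z n| <=
     C * (n.+1%:R `^ (- b) + (`|x n| + `|y n|) ^+ 2) / n.+1%:R) ->
    (\forall n \near \oo, `|z n.+1 - (1 - c / n.+1%:R) * z n| <=
      C' * n.+1%:R `^ (- tau) / n.+1%:R).
  move=> Hz; near=> n.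
  apply: (@le_trans _ _ (C * (n.+1%:R `^ (- b) + (`|x n| + `|y n|) ^+ 2) / n.+1%:R)).
    by near: n.
  by near: n.
split.
  apply: (@cvgn_rescaled_contraction R r tau C' 1) => //; last exact: contr'.
  by move/cvgr0Pnorm_le : x0; apply.
(* The second coordinate contracts at rate [mu > r] with an error of rate [tau > r], so it decays
   faster than [n^(-r)]. The cap at 1 keeps the rate [(r+q)/2] in the range allowed by
   [decay_of_contraction]. *)
pose q := Num.min (Num.min mu tau) 1.
have rq : r < q by rewrite lt_min r1 andbT lt_min rmu rtau.
have q1 : q <= mu by rewrite ge_min ge_min lexx.
have q2 : q <= tau by rewrite ge_min ge_min lexx orbT.
have q3 : q <= 1 by rewrite ge_min lexx orbT.
have [K' HK'] : exists K', \forall n \near \oo, `|y n| <= K' * n%:R `^ (- ((r + q) / 2)).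
  apply: (@decay_of_contraction R _ mu tau C') => //; try lra.
  near=> n.
  apply: (@le_trans _ _ ((1 - mu / n.+1%:R) * `|y n| +
     C * (n.+1%:R `^ (- b) + N n ^+ 2) / n.+1%:R)); first by near: n.
  by rewrite lerD2l; near: n.
apply/norm_cvg0P.
apply: (@squeeze_cvgr _ _ _ _ (fun=> 0) (fun n => K' * n%:R `^ (- ((q - r) / 2)))).
- near=> n; apply/andP; split => //.
  have n0 : 0 < n%:R :> R by rewrite ltr0n; near: n; exists 1%N.
  rewrite normrM (ger0_norm (powR_ge0 _ _)).
  have : `|y n| <= K' * n%:R `^ (- ((r + q) / 2)) by near: n.
  move/(ler_wpM2l (powR_ge0 n%:R r))/le_trans; apply.
  rewrite mulrCA -powRD ?(gt_eqF n0) ?implybT //.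
  by rewrite (_ : r - (r + q) / 2 = - ((q - r) / 2)) //; field.
- exact: cvg_cst.
- by rewrite -[0](mulr0 K'); apply: cvgMr; apply: cvgn_powRN; lra.
Unshelve. all: by end_near.
Qed.

(** * The drift along a trajectory *)

Lemma derive1_quadratic (R : realType) (a b c x : R) :
  derive1 (fun t => a * t ^+ 2 + b * t + c) x = 2 * a * x + b.
Proof.
rewrite derive1E.
have -> : (fun t => a * t ^+ 2 + b * t + c) =
   (a *: (fun t : R => t) ^+ 2 + b *: (fun t : R => t) + cst c)%R.
  by apply/funext => t /=; rewrite /cst /=.
have H1 : is_derive x 1 (fun t : R => t) 1 by exact: is_derive_id.
have H2 := is_deriveD (is_deriveD (is_deriveZ a (is_deriveX 2 H1)) (is_deriveZ b H1))
  (is_derive_cst c x 1).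
by rewrite (@derive_val _ _ _ _ _ _ _ H2) addr0 /GRing.scale /=; ring.
Qed.

Lemma JpE (R : realType) (p : R) (g : 'cV[R]_2) :
  let x1 := g 0 0 in let x2 := g 1 0 in
  let s := 2 * (1 - x1 - x2) in
  let b1 := 2 * ((1 - p) * x1 + p * x2 - 1) in
  let b2 := 2 * ((1 - p) * x2 + p * x1 - 1) in
  [/\ Jp p g 0 0 = b1 * (1 - p) + s - 1, Jp p g 0 1 = b1 * p + s,
      Jp p g 1 0 = b2 * p + s & Jp p g 1 1 = b2 * (1 - p) + s - 1].
Proof.
move=> x1 x2 s b1 b2; rewrite /Jp !mxE /= /hcomp /= -/x1 -/x2; split.
- rewrite (_ : (fun t => _) = (fun t => ((1 - p) ^+ 2 - 1) * t ^+ 2 +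
    (2 * (1 - p) * (p * x2 - 1) + 2 * (1 - x2) - 1) * t +
    ((p * x2 - 1) ^+ 2 - (1 - x2) ^+ 2))); last by apply/funext => t; rewrite /h1; ring.
  by rewrite derive1_quadratic /b1 /s; ring.
- rewrite (_ : (fun t => _) = (fun t => (p ^+ 2 - 1) * t ^+ 2 +
    (2 * p * ((1 - p) * x1 - 1) + 2 * (1 - x1)) * t +
    (((1 - p) * x1 - 1) ^+ 2 - (1 - x1) ^+ 2 - x1))); last by apply/funext => t; rewrite /h1; ring.
  by rewrite derive1_quadratic /b1 /s; ring.
- rewrite (_ : (fun t => _) = (fun t => (p ^+ 2 - 1) * t ^+ 2 +
    (2 * p * ((1 - p) * x2 - 1) + 2 * (1 - x2)) * t +
    (((1 - p) * x2 - 1) ^+ 2 - (1 - x2) ^+ 2 - x2))); last by apply/funext => t; rewrite /h2; ring.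
  by rewrite derive1_quadratic /b2 /s; ring.
- rewrite (_ : (fun t => _) = (fun t => ((1 - p) ^+ 2 - 1) * t ^+ 2 +
    (2 * (1 - p) * (p * x1 - 1) + 2 * (1 - x1) - 1) * t +
    ((p * x1 - 1) ^+ 2 - (1 - x1) ^+ 2))); last by apply/funext => t; rewrite /h2; ring.
  by rewrite derive1_quadratic /b2 /s; ring.
Qed.

(** The drift is a quadratic polynomial, so its second-order expansion is exact and the remainder is
    its quadratic part at the increment. *)
Lemma h_Taylor (R : realType) (p : R) (g : 'cV[R]_2) (w1 w2 : R) :
  h1 p (g 0 0 + w1) (g 1 0 + w2) = h1 p (g 0 0) (g 1 0) +
    (Jp p g 0 0 * w1 + Jp p g 0 1 * w2) + (((1 - p) * w1 + p * w2) ^+ 2 - (w1 + w2) ^+ 2) /\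
  h2 p (g 0 0 + w1) (g 1 0 + w2) = h2 p (g 0 0) (g 1 0) +
    (Jp p g 1 0 * w1 + Jp p g 1 1 * w2) + (((1 - p) * w2 + p * w1) ^+ 2 - (w1 + w2) ^+ 2).
Proof.
have [-> -> -> ->] := JpE R p g; rewrite /h1 /h2; split; ring.
Qed.

Lemma quadratic_remainder_le (R : realType) (p w1 w2 : R) : 0 < p < 1 ->
  `|((1 - p) * w1 + p * w2) ^+ 2 - (w1 + w2) ^+ 2| <= (`|w1| + `|w2|) ^+ 2.
Proof.
move=> /andP[p0 p1].
have sq (u W : R) : `|u| <= W -> 0 <= u ^+ 2 <= W ^+ 2.
  move=> uW; rewrite sqr_ge0 /= -real_normK ?num_real // ler_pXn2r // nnegrE //.
  exact: le_trans uW.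
have /sq/andP[A1 A2] := ler_normD w1 w2.
have /sq/andP[B1 B2] : `|(1 - p) * w1 + p * w2| <= `|w1| + `|w2|.
  apply: le_trans (ler_normD _ _) _; rewrite !normrM (gtr0_norm p0) ger0_norm; last lra.
  by apply: lerD; rewrite ler_piMl //; lra.
rewrite ler_norml; apply/andP; split; lra.
Qed.

Lemma cvgn_comb (R : realType) (a b l m : R) (x y : nat -> R) :
  x @ \oo --> l -> y @ \oo --> m -> (fun n => a * x n + b * y n) @ \oo --> a * l + b * m.
Proof. by move=> xl ym; apply: cvgD; apply: cvgMr. Qed.

(** [x n - M n / n] is the Cesaro mean of [f]. With [f = h(x) + x] the two limits are [h(g) + g] and
    [g], so their equality says that the drift vanishes at [g]. *)
Lemma averaged_drift_eq0 (R : realType) (f x M : nat -> R) (l g : R) :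
  (forall n, n%:R * x n = \sum_(0 <= k < n) f k + M n) ->
  (fun n => M n / n%:R) @ \oo --> (0 : R) -> f @ \oo --> l -> x @ \oo --> g -> l = g.
Proof.
move=> xE M0 fl xg.
have H := @cesaro _ f l fl.
have H2 : (fun n => x n.+1 - M n.+1 / n.+1%:R) @ \oo --> g - 0.
  by apply: cvgB; [rewrite (cvg_shiftS x) | rewrite (cvg_shiftS (fun n => M n / n%:R))].
rewrite subr0 in H2.
suff E : arithmetic_mean f = (fun n => x n.+1 - M n.+1 / n.+1%:R).
  by rewrite E in H; exact: cvg_unique H H2.
apply/funext => n; rewrite /arithmetic_mean /series /=.
have n0 : n.+1%:R != 0 :> R by rewrite pnatr_eq0.
apply: (mulfI n0); rewrite mulrA mulfV // mul1r mulrBr (xE n.+1).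
by rewrite mulrC mulfVK //; ring.
Qed.

Lemma sqrt_ln_le_powR (R : realType) (b : R) : b < 1 / 2 ->
  \forall n \near \oo, n%:R `^ (1 / 2) * ln n%:R <= (1 / 2 - b)^-1 * n%:R `^ (1 - b) :> R.
Proof.
move=> b2; exists 1%N => // n /= n0.
have n0' : 0 < n%:R :> R by rewrite ltr0n.
have e0 : 0 < 1 / 2 - b by rewrite subr_gt0.
have -> : n%:R `^ (1 - b) = n%:R `^ (1 / 2) * n%:R `^ (1 / 2 - b) :> R.
  by rewrite -powRD ?(gt_eqF n0') ?implybT //; congr (_ `^ _); field.
rewrite mulrCA ler_pM2l ?powR_gt0 // ler_pdivlMl // -ln_powR.
by apply/ltW/ln_sublinear; rewrite powR_gt0.
Qed.

(* Subtracting the averaged noise [M n / n%:R] leaves the Cesaro mean of the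
   conditional step probabilities, which obeys a recursion without noise. *)
Lemma left_eigenvector_recursion (R : realType) (p b K lam : R) (x1 x2 M1 M2 : nat -> R)
    (g : 'cV[R]_2) (u : 'rV[R]_2) :
  let y1 := fun n => x1 n - M1 n / n%:R - g 0 0 in
  let y2 := fun n => x2 n - M2 n / n%:R - g 1 0 in
  let a := fun n => u 0 0 * y1 n + u 0 1 * y2 n in
  0 < p < 1 -> 0 < b ->
  (forall n, n%:R * x1 n = \sum_(0 <= k < n) (h1 p (x1 k) (x2 k) + x1 k) + M1 n) ->
  (forall n, n%:R * x2 n = \sum_(0 <= k < n) (h2 p (x1 k) (x2 k) + x2 k) + M2 n) ->
  (\forall n \near \oo, `|M1 n| <= K * n%:R `^ (1 - b)) ->
  (\forall n \near \oo, `|M2 n| <= K * n%:R `^ (1 - b)) ->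
  h1 p (g 0 0) (g 1 0) = 0 -> h2 p (g 0 0) (g 1 0) = 0 ->
  u *m Jp p g = lam *: u ->
  exists C, 0 <= C /\
    \forall n \near \oo, `|a n.+1 - (1 + lam / n.+1%:R) * a n| <=
      C * (n.+1%:R `^ (- b) + (`|y1 n| + `|y2 n|) ^+ 2) / n.+1%:R.
Proof.
move=> y1 y2 a p01 b0 x1E x2E M1b M2b hg1 hg2 uJ.
have [J0 J1] : u 0 0 * Jp p g 0 0 + u 0 1 * Jp p g 1 0 = lam * u 0 0 /\
    u 0 0 * Jp p g 0 1 + u 0 1 * Jp p g 1 1 = lam * u 0 1.
  split; [have /rowP/(_ 0) := uJ | have /rowP/(_ 1) := uJ];
  rewrite mxE [RHS]mxE !big_ord_recl big_ord0 addr0;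
  by rewrite (_ : lift ord0 ord0 = 1) //; exact/val_inj.
pose De n := `|M1 n / n%:R| + `|M2 n / n%:R|.
have De0 n : 0 <= De n by exact: addr_ge0.
have K0 : 0 <= K.
  have [N _ HN] := M1b.
  have := HN (maxn N 1%N) (leq_maxl _ _) => /(le_trans (normr_ge0 _)).
  by rewrite pmulr_lge0 // powR_gt0 // ltr0n leq_max orbT.
have Deb : \forall n \near \oo, De n <= 2 * K * n%:R `^ (- b).
  near=> n.
  have n0 : 0 < n%:R :> R by rewrite ltr0n; near: n; exists 1%N.
  have E (M : nat -> R) : `|M n| <= K * n%:R `^ (1 - b) -> `|M n / n%:R| <= K * n%:R `^ (- b).
    have -> : n%:R `^ (1 - b) = n%:R `^ (- b) * n%:R :> R.
      rewrite -[X in _ * X]powRr1 ?ltW // -powRD ?(gt_eqF n0) ?implybT //.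
      by rewrite addrC.
    by rewrite normrM normfV (ger0_norm (ltW n0)) ler_pdivrMr // mulrA.
  rewrite /De -mulrA mulr_natl mulr2n; apply: lerD; apply: E; near: n; assumption.
pose U := `|u 0 0| + `|u 0 1|.
have U0 : 0 <= U by exact: addr_ge0.
have lam4 : 0 <= `|lam| + 5 by rewrite addr_ge0.
pose C := U * (`|lam| + 5) * (2 * K * 2 `^ b + 1).
have C0 : 0 <= C.
  by rewrite !mulr_ge0 // addr_ge0 // !mulr_ge0 // powR_ge0.
exists C; split=> //; near=> n.
have n0 : (0 < n)%N by near: n; exists 1%N.
have n0' : 0 < n%:R :> R by rewrite ltr0n.
have m0 : 0 < n.+1%:R :> R by rewrite ltr0n.
(* Smallness of the averaged noise allows [De^2 <= De] below, so that [(Y + De)^2 <= 2 Y^2 + 2 De]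
   has an error linear in [De]. *)
have De1 : De n <= 1.
  apply: (@le_trans _ _ (2 * K * n%:R `^ (- b))); first by near: n.
  have Hs : n%:R `^ (- b) <= (2 * K + 1)^-1 :> R.
    rewrite -[leLHS]ger0_norm ?powR_ge0 //; near: n.
    by apply: (cvgr0_norm_le _ (cvgn_powRN R b b0)); rewrite invr_gt0 ltr_wpDl // mulr_ge0.
  have K1 : 0 < 2 * K + 1 by rewrite ltr_wpDl // mulr_ge0.
  move: Hs; rewrite -[(2 * K + 1)^-1]mul1r ler_pdivlMr // => Hs.
  by have := powR_ge0 n%:R (- b); nra.
have Dem : De n <= 2 * K * 2 `^ b * n.+1%:R `^ (- b).
  apply: (@le_trans _ _ (2 * K * n%:R `^ (- b))); first by near: n.
  by rewrite -[leRHS]mulrA ler_wpM2l ?mulr_ge0 // powRN_succ_le // ltW.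
pose d1 := M1 n / n%:R; pose d2 := M2 n / n%:R.
have [T1 T2] := h_Taylor R p g (y1 n + d1) (y2 n + d2).
have ex1 : g 0 0 + (y1 n + d1) = x1 n by rewrite /y1 /d1; ring.
have ex2 : g 1 0 + (y2 n + d2) = x2 n by rewrite /y2 /d2; ring.
rewrite ex1 ex2 hg1 add0r in T1; rewrite ex1 ex2 hg2 add0r in T2.
set q1 := _ ^+ 2 - _ in T1; set q2 := _ ^+ 2 - _ in T2.
(* [n x_n - M_n] is a partial sum of [h + x]. Passing from [n] to [n+1] adds one known term, so no
   noise increment appears on the right, only the average [M_n / n]. *)
have rec (x M h : nat -> R) (c : R) :
    (forall n, n%:R * x n = \sum_(0 <= k < n) (h k + x k) + M n) ->
    x n.+1 - M n.+1 / n.+1%:R - c =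
    (x n - M n / n%:R - c) + (h n + M n / n%:R) / n.+1%:R.
  move=> xE; have := xE n.+1; rewrite big_nat_recr //= => E1.
  have E2 : \sum_(0 <= k < n) (h k + x k) = n%:R * x n - M n by rewrite xE; ring.
  rewrite E2 in E1.
  have -> : x n.+1 = (n.+1%:R * x n.+1) / n.+1%:R by rewrite mulrC mulKf // gt_eqF.
  rewrite E1; move: m0; rewrite -natr1 => m0.
  by field; rewrite !gt_eqF.
have r1 := rec x1 M1 (fun k => h1 p (x1 k) (x2 k)) (g 0 0) x1E.
have r2 := rec x2 M2 (fun k => h2 p (x1 k) (x2 k)) (g 1 0) x2E.
rewrite -/(y1 n.+1) -/(y1 n) -/d1 /= T1 in r1.
rewrite -/(y2 n.+1) -/(y2 n) -/d2 /= T2 in r2.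
(* The drift is expanded at [y + d], with [d] the averaged noise. Since [u J = lam u], the term
   [lam u y] cancels; [lam u d] joins the explicit [u d] to give the factor [lam + 1]. *)
have -> : a n.+1 - (1 + lam / n.+1%:R) * a n =
  ((lam + 1) * (u 0 0 * d1 + u 0 1 * d2) + (u 0 0 * q1 + u 0 1 * q2)) / n.+1%:R.
  rewrite /a r1 r2.
  transitivity (((u 0 0 * Jp p g 0 0 + u 0 1 * Jp p g 1 0) * (y1 n + d1) +
    (u 0 0 * Jp p g 0 1 + u 0 1 * Jp p g 1 1) * (y2 n + d2) - lam * (u 0 0 * y1 n + u 0 1 * y2 n)
     + (u 0 0 * d1 + u 0 1 * d2) + (u 0 0 * q1 + u 0 1 * q2)) / n.+1%:R); first by ring.
  by rewrite J0 J1; ring.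
rewrite normrM [`|_^-1|]ger0_norm ?invr_ge0 ?ler0n //; apply: ler_wpM2r; first by rewrite invr_ge0.
pose Y := `|y1 n| + `|y2 n|.
have Y0 : 0 <= Y by exact: addr_ge0.
have Q : (`|y1 n + d1| + `|y2 n + d2|) ^+ 2 <= 2 * Y ^+ 2 + 2 * De n.
  apply: (@le_trans _ _ ((Y + De n) ^+ 2)).
    rewrite ler_pXn2r ?nnegrE ?addr_ge0 //.
    apply: (@le_trans _ _ ((`|y1 n| + `|d1|) + (`|y2 n| + `|d2|))).
      by apply: lerD; exact: ler_normD.
    by rewrite /Y /De le_eqVlt; apply/orP; left; apply/eqP; rewrite /d1 /d2; ring.
  by have := De0 n; have := sqr_ge0 (Y - De n); move: De1; nra.
have Q1 : `|q1| <= 2 * Y ^+ 2 + 2 * De n.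
  by apply: le_trans Q; exact: quadratic_remainder_le.
have Q2 : `|q2| <= 2 * Y ^+ 2 + 2 * De n.
  apply: le_trans Q; rewrite /q2 [X in _ - X ^+ 2]addrC [leRHS](_ : _ = (`|y2 n + d2| + `|y1 n + d1|) ^+ 2).
    exact: quadratic_remainder_le.
  by congr (_ ^+ 2); rewrite addrC.
have comb (s1 s2 B : R) : 0 <= B -> `|s1| <= B -> `|s2| <= B -> `|u 0 0 * s1 + u 0 1 * s2| <= U * B.
  move=> B0 s1B s2B; apply: le_trans (ler_normD _ _) _; rewrite !normrM /U mulrDl.
  by apply: lerD; rewrite ler_wpM2l.
have W0 : 0 <= 2 * Y ^+ 2 + 2 * De n by rewrite addr_ge0 ?mulr_ge0 ?sqr_ge0.
have d1D : `|d1| <= De n by rewrite /De lerDl.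
have d2D : `|d2| <= De n by rewrite /De lerDr.
apply: le_trans (ler_normD _ _) _.
have A1 : `|(lam + 1) * (u 0 0 * d1 + u 0 1 * d2)| <= (`|lam| + 1) * (U * De n).
  rewrite normrM; apply: ler_pM => //; last exact: comb.
  by apply: le_trans (ler_normD _ _) _; rewrite normr1.
have A2 := comb q1 q2 _ W0 Q1 Q2.
apply: le_trans (lerD A1 A2) _.
set B := n.+1%:R `^ (- b); rewrite -/B in Dem.
have B0 : 0 <= B by exact: powR_ge0.
have X0 : 0 <= Y ^+ 2 by exact: sqr_ge0.
apply: (@le_trans _ _ (U * (`|lam| + 5) * (De n + Y ^+ 2))).
  have -> : U * (`|lam| + 5) * (De n + Y ^+ 2) =
    (`|lam| + 1) * (U * De n) + U * (2 * Y ^+ 2 + 2 * De n) + U * (2 * De n + (`|lam| + 3) * Y ^+ 2) by ring.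
  rewrite lerDl mulr_ge0 // addr_ge0 ?mulr_ge0 //.
rewrite /C -[leRHS]mulrA; apply: ler_wpM2l; first exact: mulr_ge0.
have W1 : 0 <= 2 * K * 2 `^ b by rewrite !mulr_ge0 // powR_ge0.
rewrite -/Y; move: (2 * K * 2 `^ b) W1 Dem => k k0 Dem.
rewrite mulrDl mul1r mulrDr; have := mulr_ge0 k0 X0; lra.
Unshelve. all: by end_near.
Qed.

(** [lam1] takes the default value 0 when no greatest eigenvalue exists, so strict negativity
    certifies that a genuine eigenvalue was picked. The same holds for [lam2]. *)
Lemma eigenvalue_lam1 (R : realType) (p : R) (g : 'cV[R]_2) :
  lam1 p g < 0 -> eigenvalue (Jp p g) (lam1 p g).
Proof. by rewrite /lam1; case: xgetP => [x _ []//|_]; rewrite ltxx. Qed.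

Lemma eigenvalue_lam2 (R : realType) (p : R) (g : 'cV[R]_2) :
  lam2 p g < 0 -> eigenvalue (Jp p g) (lam2 p g).
Proof. by rewrite /lam2; case: xgetP => [x _ []//|_]; rewrite ltxx. Qed.

(** If the determinant vanished, [v] would be a multiple of [u] and the two eigenvalues would agree.
    Invertibility is what allows a vector to be recovered from its pairings with both left
    eigenvectors. *)
Lemma eigenvectors2_det_neq0 (F : fieldType) (J : 'M[F]_2) (a b : F) (u v : 'rV[F]_2) :
  u *m J = a *: u -> v *m J = b *: v -> u != 0 -> v != 0 -> a != b ->
  u 0 0 * v 0 1 - u 0 1 * v 0 0 != 0.
Proof.
move=> uJ vJ u0 v0 ab; apply/negP => /eqP/subr0_eq D.
have rowE (w : 'rV[F]_2) : w 0 0 = 0 -> w 0 1 = 0 -> w = 0.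
  move=> w0 w1; apply/rowP => i; rewrite mxE.
  case: i => [[|[|//]]] Hi.
    by rewrite (_ : Ordinal Hi = 0) //; exact/val_inj.
  by rewrite (_ : Ordinal Hi = 1) //; exact/val_inj.
have [t vE] : exists t, v = t *: u.
  have [u00|u00] := eqVneq (u 0 0) 0.
    have u01 : u 0 1 != 0 by apply: contra u0 => /eqP u01; apply/eqP/rowE.
    exists (v 0 1 / u 0 1); apply/eqP; rewrite -subr_eq0; apply/eqP/rowE; rewrite !mxE.
      move: D; rewrite u00 mul0r mulr0 subr0 => /esym/eqP.
      by rewrite mulf_eq0 (negbTE u01) /= => /eqP.
    by rewrite mulfVK // subrr.
  exists (v 0 0 / u 0 0); apply/eqP; rewrite -subr_eq0; apply/eqP/rowE; rewrite !mxE.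
    by rewrite mulfVK // subrr.
  apply: (mulfI u00); rewrite mulr0 mulrBr D.
  by field.
have t0 : t != 0 by apply: contra v0 => /eqP t0; rewrite vE t0 scale0r.
have : (t * (a - b)) *: u = 0.
  by move: vJ; rewrite vE -scalemxAl uJ !scalerA => E; rewrite mulrBr scalerBl E mulrC subrr.
by move/eqP; rewrite scaler_eq0 (negbTE u0) mulf_eq0 (negbTE t0) subr_eq0 (negbTE ab).
Qed.

Lemma walk_drift_eq0 (R : realType) (p : R) (x1 x2 M1 M2 : nat -> R) (g : 'cV[R]_2) :
  (forall n, n%:R * x1 n = \sum_(0 <= k < n) (h1 p (x1 k) (x2 k) + x1 k) + M1 n) ->
  (forall n, n%:R * x2 n = \sum_(0 <= k < n) (h2 p (x1 k) (x2 k) + x2 k) + M2 n) ->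
  (fun n => M1 n / n%:R) @ \oo --> (0 : R) ->
  (fun n => M2 n / n%:R) @ \oo --> (0 : R) ->
  x1 @ \oo --> g 0 0 -> x2 @ \oo --> g 1 0 ->
  h1 p (g 0 0) (g 1 0) = 0 /\ h2 p (g 0 0) (g 1 0) = 0.
Proof.
move=> x1E x2E M10 M20 x1g x2g.
have sq (f : nat -> R) (l : R) : f @ \oo --> l -> (fun n => f n ^+ 2) @ \oo --> l ^+ 2.
  by move=> fl; apply: cvgM.
have c1 : (cst 1 : nat -> R) @ \oo --> (1 : R) by exact: cvg_cst.
have S : (fun n => (1 - x1 n - x2 n) ^+ 2) @ \oo --> (1 - g 0 0 - g 1 0) ^+ 2.
  by apply: sq; apply: cvgB => //; apply: cvgB.
split.
- suff : h1 p (g 0 0) (g 1 0) + g 0 0 = g 0 0 by move/(canRL (addrK _)); rewrite subrr.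
  apply: (averaged_drift_eq0 _ _ _ _ _ _ x1E M10 _ x1g).
  apply: cvgD => //; apply: cvgB => //; apply: cvgB => //; apply: sq.
  by apply: cvgB => //; exact: cvgn_comb.
- suff : h2 p (g 0 0) (g 1 0) + g 1 0 = g 1 0 by move/(canRL (addrK _)); rewrite subrr.
  apply: (averaged_drift_eq0 _ _ _ _ _ _ x2E M20 _ x2g).
  apply: cvgD => //; apply: cvgB => //; apply: cvgB => //; apply: sq.
  by apply: cvgB => //; exact: cvgn_comb.
Qed.

Lemma rescaled_noise_cvg0 (R : realType) (M : nat -> R) (b K s : R) : s < b ->
  (\forall n \near \oo, `|M n| <= K * n%:R `^ (1 - b)) ->
  (fun n => n%:R `^ s * (M n / n%:R)) @ \oo --> (0 : R).
Proof.
move=> sb HM; apply/norm_cvg0P.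
apply: (@squeeze_cvgr _ _ _ _ (fun=> 0) (fun n => K * n%:R `^ (- (b - s)))).
- near=> n; apply/andP; split => //.
  have n0 : 0 < n%:R :> R by rewrite ltr0n; near: n; exists 1%N.
  rewrite !normrM normfV (ger0_norm (powR_ge0 _ _)) (ger0_norm (ltW n0)).
  have Mn : `|M n| <= K * n%:R `^ (1 - b) by near: n.
  have -> : n%:R `^ (- (b - s)) = n%:R `^ s * (n%:R `^ (1 - b) / n%:R) :> R.
    rewrite -[X in _ / X]powRr1 ?ltW // -powRN -!powRD ?(gt_eqF n0) ?implybT //.
    by congr (_ `^ _); ring.
  rewrite [leRHS]mulrCA ler_wpM2l ?powR_ge0 // mulrA ler_wpM2r // invr_ge0 ltW //.
- exact: cvg_cst.
- rewrite -[0](mulr0 K); apply: cvgMr; apply: cvgn_powRN; lra.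
Unshelve. all: by end_near.
Qed.

Lemma noise_le_powR (R : realType) (M : nat -> R) (b : R) : b < 1 / 2 ->
  (\forall n \near \oo, `|M n| <= 4 * (n%:R `^ (1 / 2) * ln n%:R)) ->
  \forall n \near \oo, `|M n| <= 4 * (1 / 2 - b)^-1 * n%:R `^ (1 - b).
Proof.
move=> b2 Ms; near=> n.
apply: (@le_trans _ _ (4 * (n%:R `^ (1 / 2) * ln n%:R))); first by near: n.
by rewrite -mulrA ler_pM2l //; near: n; exact: sqrt_ln_le_powR.
Unshelve. all: by end_near.
Qed.

Lemma noise_average_cvg0 (R : realType) (M : nat -> R) :
  (\forall n \near \oo, `|M n| <= 4 * (n%:R `^ (1 / 2) * ln n%:R)) ->
  (fun n => M n / n%:R) @ \oo --> (0 : R).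
Proof.
have b2 : 1 / 4 < 1 / 2 :> R by lra.
have b0 : 0 < 1 / 4 :> R by lra.
move=> /(noise_le_powR _ _ _ b2)/(rescaled_noise_cvg0 _ _ _ _ _ b0).
apply: cvg_trans; apply: near_eq_cvg.
by apply: nearW => n; rewrite powRr0 mul1r.
Qed.

Lemma walk_path_cvg (R : realType) (p : R) (x1 x2 M1 M2 : nat -> R) (g v : 'cV[R]_2) :
  0 < p < 1 ->
  (forall n, n%:R * x1 n = \sum_(0 <= k < n) (h1 p (x1 k) (x2 k) + x1 k) + M1 n) ->
  (forall n, n%:R * x2 n = \sum_(0 <= k < n) (h2 p (x1 k) (x2 k) + x2 k) + M2 n) ->
  (\forall n \near \oo, `|M1 n| <= 4 * (n%:R `^ (1 / 2) * ln n%:R)) ->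
  (\forall n \near \oo, `|M2 n| <= 4 * (n%:R `^ (1 / 2) * ln n%:R)) ->
  x1 @ \oo --> g 0 0 -> x2 @ \oo --> g 1 0 ->
  lam2 p g < - (1 / 2) < lam1 p g -> lam1 p g < 0 ->
  cvgn (fun n => (v^T *m (vec2 (x1 n) (x2 n) - g)) 0 0 / n%:R `^ lam1 p g).
Proof.
move=> p01 x1E x2E M1s M2s x1g x2g /andP[l2 l1] l10.
(* [b] is the midpoint of [r] and [1/2]: above [r], so that noise of order [n^(-b)] is negligible
   after rescaling, and below [1/2], so that the logarithm in the noise bound is absorbed. *)
pose r := - lam1 p g; pose b := (r + 1 / 2) / 2.
have [r0 r2] : 0 < r /\ r < 1 / 2 by rewrite /r; split; lra.
have [rb b2] : r < b /\ b < 1 / 2 by rewrite /b; split; lra.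
have b0 : 0 < b by exact: lt_trans rb.
pose K := 4 * (1 / 2 - b)^-1.
have M1b := noise_le_powR _ _ _ b2 M1s.
have M2b := noise_le_powR _ _ _ b2 M2s.
rewrite -/K in M1b M2b.
have M10 := noise_average_cvg0 _ _ M1s. have M20 := noise_average_cvg0 _ _ M2s.
have [hg1 hg2] := walk_drift_eq0 _ _ _ _ _ _ _ x1E x2E M10 M20 x1g x2g.
pose y1 n := x1 n - M1 n / n%:R - g 0 0.
pose y2 n := x2 n - M2 n / n%:R - g 1 0.
have y10 : y1 @ \oo --> (0 : R).
  have -> : 0 = g 0 0 - 0 - g 0 0 :> R by ring.
  by apply: cvgB; [exact: cvgB | exact: cvg_cst].
have y20 : y2 @ \oo --> (0 : R).
  have -> : 0 = g 1 0 - 0 - g 1 0 :> R by ring.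
  by apply: cvgB; [exact: cvgB | exact: cvg_cst].
have /eigenvalueP[u uJ u0] := eigenvalue_lam1 _ _ _ l10.
have l20 : lam2 p g < 0 by apply: lt_trans l2 _; lra.
have /eigenvalueP[w wJ w0] := eigenvalue_lam2 _ _ _ l20.
have l12 : lam1 p g != lam2 p g by rewrite gt_eqF // (lt_trans l2 l1).
have D := eigenvectors2_det_neq0 _ _ _ _ _ _ uJ wJ u0 w0 l12.
have [C1 [C10 A1]] := left_eigenvector_recursion _ _ _ _ _ _ _ _ _ _ _ p01 b0 x1E x2E M1b M2b hg1 hg2 uJ.
have [C2 [C20 A2]] := left_eigenvector_recursion _ _ _ _ _ _ _ _ _ _ _ p01 b0 x1E x2E M1b M2b hg1 hg2 wJ.
pose a1 n := u 0 0 * y1 n + u 0 1 * y2 n.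
pose a2 n := w 0 0 * y1 n + w 0 1 * y2 n.
(* [y1] and [y2] are recovered from the pairings [a1], [a2] by Cramer's rule. [E] is the resulting
   norm comparison and turns errors quadratic in [y] into errors quadratic in [a]. *)
pose d := u 0 0 * w 0 1 - u 0 1 * w 0 0.
have y1E n : y1 n = w 0 1 / d * a1 n + - u 0 1 / d * a2 n by rewrite /a1 /a2 /d; field.
have y2E n : y2 n = - w 0 0 / d * a1 n + u 0 0 / d * a2 n by rewrite /a1 /a2 /d; field.
pose E := `|w 0 1 / d| + `|- u 0 1 / d| + `|- w 0 0 / d| + `|u 0 0 / d|.
have E0 : 0 <= E by rewrite !addr_ge0.
have yE n : `|y1 n| + `|y2 n| <= E * (`|a1 n| + `|a2 n|).
  rewrite y1E y2E; apply: le_trans (lerD (ler_normD _ _) (ler_normD _ _)) _.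
  rewrite !normrM /E !normrM.
  have e1 := mulr_ge0 (normr_ge0 (w 0 1)) (normr_ge0 d^-1).
  have e2 := mulr_ge0 (normr_ge0 (- u 0 1)) (normr_ge0 d^-1).
  have e3 := mulr_ge0 (normr_ge0 (- w 0 0)) (normr_ge0 d^-1).
  have e4 := mulr_ge0 (normr_ge0 (u 0 0)) (normr_ge0 d^-1).
  have f1 := normr_ge0 (a1 n). have f2 := normr_ge0 (a2 n).
  have := mulr_ge0 e1 f2; have := mulr_ge0 e2 f1; have := mulr_ge0 e3 f2; have := mulr_ge0 e4 f1.
  lra.
pose C := (C1 + C2) * (1 + E ^+ 2).
have C0 : 0 <= C by rewrite mulr_ge0 ?addr_ge0 // sqr_ge0.
have conv (c : R) n : 0 <= c <= C1 + C2 ->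
    c * (n.+1%:R `^ (- b) + (`|y1 n| + `|y2 n|) ^+ 2) / n.+1%:R <=
    C * (n.+1%:R `^ (- b) + (`|a1 n| + `|a2 n|) ^+ 2) / n.+1%:R.
  move=> /andP[c0 cC]; apply: ler_wpM2r; first by rewrite invr_ge0.
  have P0 := powR_ge0 n.+1%:R (- b).
  have S0 := sqr_ge0 (`|a1 n| + `|a2 n|).
  rewrite /C -mulrA; apply: ler_pM => //.
  have : (`|y1 n| + `|y2 n|) ^+ 2 <= (E * (`|a1 n| + `|a2 n|)) ^+ 2.
    by rewrite ler_pXn2r ?nnegrE ?mulr_ge0 ?addr_ge0.
  rewrite exprMn; have := mulr_ge0 (sqr_ge0 E) P0; lra.
have [cv1 cv2] : cvgn (fun n => n%:R `^ r * a1 n) /\ (fun n => n%:R `^ r * a2 n) @ \oo --> (0 : R).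
  apply: (@planar_contraction R r (- lam2 p g) b C) => //.
  - by rewrite r0 /=; lra.
  - by rewrite /r; lra.
  - have -> : 0 = u 0 0 * 0 + u 0 1 * 0 :> R by ring.
    exact: cvgn_comb.
  - have -> : 0 = w 0 0 * 0 + w 0 1 * 0 :> R by ring.
    exact: cvgn_comb.
  - near=> n.
    apply: le_trans (conv C1 n _); last by rewrite C10 lerDl.
    by rewrite /r mulNr opprK; near: n.
  - near=> n.
    apply: le_trans (conv C2 n _); last by rewrite C20 lerDr.
    by rewrite mulNr opprK; near: n.
move/cvg_ex : cv1 => [l cv1].
have N1 := rescaled_noise_cvg0 _ _ _ _ _ rb M1b.
have N2 := rescaled_noise_cvg0 _ _ _ _ _ rb M2b.
(* [e1] and [e2] are the coefficients of [v] in terms of the left eigenvectors [u] and [w], so [v]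
   paired with [y] is [e1 a1 + e2 a2]; the averaged noise is added back separately. *)
pose e1 := v 0 0 * (w 0 1 / d) + v 1 0 * (- w 0 0 / d).
pose e2 := v 0 0 * (- u 0 1 / d) + v 1 0 * (u 0 0 / d).
have F : (fun n => (e1 * (n%:R `^ r * a1 n) + e2 * (n%:R `^ r * a2 n)) +
    (v 0 0 * (n%:R `^ r * (M1 n / n%:R)) + v 1 0 * (n%:R `^ r * (M2 n / n%:R)))) @ \oo -->
    e1 * l + e2 * 0 + (v 0 0 * 0 + v 1 0 * 0).
  by apply: cvgD; exact: cvgn_comb.
apply/cvg_ex; exists (e1 * l + e2 * 0 + (v 0 0 * 0 + v 1 0 * 0)).
apply: cvg_trans F; apply: near_eq_cvg; near=> n => /=.
rewrite mxE !big_ord_recl big_ord0 addr0 !mxE /=.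
rewrite (_ : lift ord0 ord0 = 1); last exact/val_inj.
rewrite -powRN -/r.
have -> : x1 n - g 0 0 = w 0 1 / d * a1 n + - u 0 1 / d * a2 n + M1 n / n%:R.
  by rewrite -y1E /y1; ring.
have -> : x2 n - g 1 0 = - w 0 0 / d * a1 n + u 0 0 / d * a2 n + M2 n / n%:R.
  by rewrite -y2E /y2; ring.
by rewrite /e1 /e2; ring.
Unshelve. all: by end_near.
Qed.

(** * Exponential moments of the noise *)

Section History.
Variables (R : realType) (p : R).

(* A step [+1], [-1], [0] is coded by [Some true], [Some false], [None];
   histories are stored with the latest step first. *)
Definition step_val (v : option bool) : R :=
  if v is Some s then (if s then 1 else -1) else 0.

Definition sign_act (b : bool) (v : option bool) : option bool :=
  if v is Some c then Some (b == c) else None.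

Definition clip_add (v w : option bool) : option bool :=
  match v, w with
  | None, _ => w
  | _, None => v
  | Some a, Some b => if a == b then Some a else None
  end.

Lemma step_val_clip (a b : bool) (v w : option bool) :
  Num.max (-1) (Num.min 1 (step_val (Some a) * step_val v + step_val (Some b) * step_val w))
  = step_val (clip_add (sign_act a v) (sign_act b w)).
Proof.
have mx (x : R) : x <= -1 -> Num.max (-1) x = -1 by move/max_idPl.
have mx' (x : R) : -1 <= x -> Num.max (-1) x = x by move/max_idPr.
have mn (x : R) : x <= 1 -> Num.min 1 x = x by move/min_idPr.
have mn' (x : R) : 1 <= x -> Num.min 1 x = 1 by move/min_idPl.
by case: a; case: b; case: v => [[]|]; case: w => [[]|] /=;
  rewrite ?(mulr0, mulr1, mul1r, mulN1r, opprK, addr0, add0r, subrr, addNr, oppr0);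
  (first [rewrite mn; [|lra] | rewrite mn'; [|lra]]);
  (first [rewrite mx; [|lra] | rewrite mx'; [|lra]]).
Qed.

Definition step_frac (s : bool) (xi : seq (option bool)) : R :=
  (count_mem (Some s) xi)%:R / (size xi)%:R.

(** The conditional probability of a next step of sign [s], as [step_mean_step_prob] shows.
    Exchanging the coordinates turns [h1] into [h2], so one formula serves both signs. *)
Definition step_prob (s : bool) (xi : seq (option bool)) : R :=
  h1 p (step_frac s xi) (step_frac (~~ s) xi) + step_frac s xi.

(** The martingale part of the count of steps of sign [s]. The first two steps do not come from
    memory, so their increments need not be centred; for them only boundedness is used. *)
Fixpoint noise (s : bool) (xi : seq (option bool)) : R :=
  if xi is v :: xi' then noise s xi' + ((v == Some s)%:R - step_prob s xi') else 0.

Definition rad_weight (a : bool) : R := if a then p else 1 - p.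

(** Positions count back from the latest step: position [i] recalls time [n - i], which is uniform
    exactly when [i] is. *)
Definition draw (n : nat) (xi : seq (option bool)) (x y : 'I_n * bool) : option bool :=
  clip_add (sign_act x.2 (nth None xi x.1)) (sign_act y.2 (nth None xi y.1)).

(** The conditional expectation of [f] at the extended history given [xi]: each of the two channels
    draws a position and a sign. *)
Definition step_mean (n : nat) (f : seq (option bool) -> R) (xi : seq (option bool)) : R :=
  \sum_(x : 'I_n * bool) \sum_(y : 'I_n * bool)
    (n%:R^-1 * rad_weight x.2) * (n%:R^-1 * rad_weight y.2) * f (draw n xi x y :: xi).

(* [walk_mean m f] is the expectation of [f] at the history of length [m + 2]. *)
Fixpoint walk_mean (m : nat) (f : seq (option bool) -> R) : R :=
  if m is m'.+1 then walk_mean m' (step_mean m'.+2 f)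
  else \sum_(b : bool * bool) 1 / 4 * f [:: Some b.2; Some b.1].

Hypothesis p01 : 0 < p < 1.

Lemma rad_weight_ge0 (a : bool) : 0 <= rad_weight a.
Proof. by case/andP: p01 => ? ?; case: a; rewrite /rad_weight; lra. Qed.

Let wt_ge0 n a : 0 <= n%:R^-1 * rad_weight a.
Proof. by rewrite mulr_ge0 ?rad_weight_ge0. Qed.

Lemma step_mean_le n f g xi :
  (forall v, f (v :: xi) <= g (v :: xi)) -> step_mean n f xi <= step_mean n g xi.
Proof.
move=> fg; apply: ler_sum => x _; apply: ler_sum => y _.
by rewrite ler_wpM2l // mulr_ge0.
Qed.

Lemma walk_mean_le m f g : (forall xi, size xi = m.+2 -> f xi <= g xi) ->
  walk_mean m f <= walk_mean m g.
Proof.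
elim: m f g => [|m IH] f g fg /=; last first.
  by apply: IH => xi s; apply: step_mean_le => v; apply: fg; rewrite /= s.
by apply: ler_sum => b _; rewrite ler_wpM2l // fg.
Qed.

Lemma step_meanZ n c f xi : step_mean n (fun xi => c * f xi) xi = c * step_mean n f xi.
Proof.
rewrite /step_mean big_distrr; apply: eq_bigr => x _.
by rewrite big_distrr; apply: eq_bigr => y _; rewrite /=; ring.
Qed.

Lemma walk_meanZ m c f : walk_mean m (fun xi => c * f xi) = c * walk_mean m f.
Proof.
elim: m f => [|m IH] f /=.
  by rewrite big_distrr; apply: eq_bigr => b _ /=; ring.
by rewrite -IH; congr walk_mean; apply/funext => xi; exact: step_meanZ.
Qed.

Lemma step_meanD n f g xi :
  step_mean n (fun xi => f xi + g xi) xi = step_mean n f xi + step_mean n g xi.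
Proof.
rewrite /step_mean -big_split; apply: eq_bigr => x _ /=.
by rewrite -big_split; apply: eq_bigr => y _ /=; ring.
Qed.

Lemma walk_meanD m f g :
  walk_mean m (fun xi => f xi + g xi) = walk_mean m f + walk_mean m g.
Proof.
elim: m f g => [|m IH] f g /=.
  by rewrite -big_split; apply: eq_bigr => b _ /=; ring.
by rewrite -IH; congr walk_mean; apply/funext => xi; exact: step_meanD.
Qed.

Lemma walk_mean0 m : walk_mean m (fun=> 0) = 0.
Proof.
have -> : (fun=> 0) = (fun xi : seq (option bool) => 0 * 0 : R).
  by apply/funext => xi; rewrite mul0r.
by rewrite (walk_meanZ m 0 (fun=> 0)) mul0r.
Qed.

Lemma walk_mean_sum m (I : Type) (r : seq I) (f : I -> seq (option bool) -> R) :
  walk_mean m (fun xi => \sum_(i <- r) f i xi) = \sum_(i <- r) walk_mean m (f i).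
Proof.
elim: r => [|i r IH].
  by rewrite big_nil -[RHS](walk_mean0 m); congr walk_mean; apply/funext => xi; rewrite big_nil.
rewrite big_cons -IH -walk_meanD; congr walk_mean.
by apply/funext => xi; rewrite big_cons.
Qed.

(** The expectation of [F] at the signed remembered step of a single channel. Given the history the
    channels are independent, so expectations of products factor through [channel]. *)
Let channel n xi (F : option bool -> R) : R :=
  \sum_(x : 'I_n * bool) n%:R^-1 * rad_weight x.2 * F (sign_act x.2 (nth None xi x.1)).

Let channelE n xi F : channel n xi F =
  p * (n%:R^-1 * \sum_(i < n) F (nth None xi i)) +
  (1 - p) * (n%:R^-1 * \sum_(i < n) F (sign_act false (nth None xi i))).
Proof.
rewrite /channel -(pair_big xpredT xpredT
  (fun i a => n%:R^-1 * rad_weight a * F (sign_act a (nth None xi (nat_of_ord i))))) /=.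
rewrite !big_distrr /= -big_split /=; apply: eq_bigr => i _.
rewrite big_bool /rad_weight /=.
have -> : sign_act true (nth None xi i) = nth None xi i by case: (nth None xi i) => [[]|].
by ring.
Qed.

Let sum_nth n xi (c : option bool) : size xi = n ->
  \sum_(i < n) (nth None xi i == c)%:R = (count_mem c xi)%:R :> R.
Proof.
move=> <-; rewrite -sum1_count natr_sum [RHS]big_mkcond [RHS](big_nth None) [RHS]big_mkord.
by apply: eq_bigr => i _; rewrite /=; case: eqP.
Qed.

Let countsE xi : (count_mem (Some true) xi + count_mem (Some false) xi + count_mem None xi)%N = size xi.
Proof. by elim: xi => [|[[]|] xi IH] //=; rewrite -IH; ring. Qed.

Let channel1 n xi : (0 < n)%N -> channel n xi (fun=> 1) = 1.
Proof.
move=> n0; rewrite channelE !sumr_const card_ord.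
have : n%:R != 0 :> R by rewrite pnatr_eq0 -lt0n.
by move=> ?; field.
Qed.

Let channel_some n xi s : size xi = n -> channel n xi (fun v => (v == Some s)%:R) =
  p * step_frac s xi + (1 - p) * step_frac (~~ s) xi.
Proof.
move=> sz; rewrite channelE /step_frac sz sum_nth //.
rewrite [in X in _ + X](eq_bigr (fun i : 'I_n => (nth None xi i == Some (~~ s))%:R)).
  by rewrite sum_nth //; ring.
by move=> i _; case: (nth None xi i) => [[]|]; case: s.
Qed.

Let channel_none n xi s : size xi = n -> (0 < n)%N -> channel n xi (fun v => (v == None)%:R) =
  1 - step_frac s xi - step_frac (~~ s) xi.
Proof.
move=> sz n0; rewrite channelE /step_frac sz sum_nth //.
rewrite [in X in _ + X](eq_bigr (fun i : 'I_n => (nth None xi i == None)%:R)); last first.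
  by move=> i _; case: (nth None xi i).
rewrite sum_nth //.
have n0' : n%:R != 0 :> R by rewrite pnatr_eq0 -lt0n.
have := countsE xi; rewrite sz => /(congr1 (fun k => k%:R : R)); rewrite !natrD => E.
have -> : (count_mem None xi)%:R = n%:R - (count_mem (Some true) xi)%:R - (count_mem (Some false) xi)%:R :> R.
  by rewrite -E; ring.
by case: s => /=; field.
Qed.

Let step_mean_prod n xi F G : 
  \sum_(x : 'I_n * bool) \sum_(y : 'I_n * bool)
    (n%:R^-1 * rad_weight x.2) * (n%:R^-1 * rad_weight y.2) *
    (F (sign_act x.2 (nth None xi x.1)) * G (sign_act y.2 (nth None xi y.1))) =
  channel n xi F * channel n xi G.
Proof.
rewrite /channel big_distrlr /=; apply: eq_bigr => x _; apply: eq_bigr => y _; ring.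
Qed.

Lemma step_mean_cst n c xi : (0 < n)%N -> step_mean n (fun=> c) xi = c.
Proof.
move=> n0; transitivity (step_mean n (fun=> c * 1) xi); first by rewrite mulr1.
rewrite step_meanZ (_ : step_mean _ _ _ = 1) ?mulr1 //.
transitivity (channel n xi (fun=> 1) * channel n xi (fun=> 1)).
  by rewrite -step_mean_prod; apply: eq_bigr => x _; apply: eq_bigr => y _; rewrite !mulr1.
by rewrite channel1 ?mulr1.
Qed.

(* The clipped sum of [v] and [w] is [s] iff neither is [-s] and they are not both [0]. *)
Lemma step_mean_step_prob n xi s : size xi = n -> (0 < n)%N ->
  step_mean n (fun xi' => (head None xi' == Some s)%:R) xi = step_prob s xi.
Proof.
move=> sz n0; pose F (v : option bool) : R := 1 - (v == Some (~~ s))%:R; pose G (v : option bool) : R := (v == None)%:R.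
have -> : step_mean n (fun xi' => (head None xi' == Some s)%:R) xi =
    channel n xi F * channel n xi F - channel n xi G * channel n xi G.
  rewrite -!step_mean_prod -sumrB; apply: eq_bigr => x _.
  rewrite -sumrB; apply: eq_bigr => y _ /=; rewrite -mulrBr; congr (_ * _).
  rewrite /draw /F /G; move: (sign_act _ _) (sign_act _ _) => v w.
  clear F G sz n0; by case: v => [[]|]; case: w => [[]|]; case: s => /=; ring.
have -> : channel n xi F = channel n xi (fun=> 1) - channel n xi (fun v : option bool => (v == Some (~~ s))%:R).
  by rewrite /channel -sumrB; apply: eq_bigr => x _; rewrite /F; ring.
rewrite channel1 // channel_some // (channel_none n xi s) // negbK /step_prob /h1; ring.
Qed.

Lemma step_prob_bounds s xi : (0 < size xi)%N -> 0 <= step_prob s xi <= 1.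
Proof.
move=> n0; rewrite -(step_mean_step_prob (size xi) xi s erefl n0).
apply/andP; split.
  by rewrite -[leLHS](step_mean_cst (size xi) 0 xi n0); apply: step_mean_le => v.
rewrite -[leRHS](step_mean_cst (size xi) 1 xi n0); apply: step_mean_le => v.
by rewrite lern1; case: eqP.
Qed.

(** From [exp x <= 1/(1-x)] and [(1 + x + 2x^2)(1 - x) = 1 + x^2 (1 - 2x)]; the last factor is where
    [x <= 1/2] enters. *)
Lemma expR_le_quadratic (x : R) : `|x| <= 1 / 2 -> expR x <= 1 + x + 2 * x ^+ 2.
Proof.
rewrite ler_norml => /andP[x1 x2].
have := expR_ge1Dx (- x); rewrite expRN => H.
have e0 := expR_gt0 x.
have y0 : 0 < 1 - x by lra.
have H2 : expR x * (1 - x) <= 1.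
  have := ler_wpM2l (ltW e0) H; rewrite mulfV ?gt_eqF //.
rewrite -(ler_pM2r y0); apply: le_trans H2 _.
have -> : (1 + x + 2 * x ^+ 2) * (1 - x) = 1 + x ^+ 2 * (1 - 2 * x) by ring.
by rewrite lerDl mulr_ge0 ?sqr_ge0 //; lra.
Qed.

(** The noise increment is a centred indicator bounded by 1. The quadratic bound on the exponential
    is affine in that indicator, so averaging kills the linear term and leaves
    [1 + 2t^2 <= exp(2t^2)]. *)
Lemma step_mean_exp_noise n xi s t : size xi = n -> (0 < n)%N -> `|t| <= 1 / 2 ->
  step_mean n (fun xi' => expR (t * noise s xi')) xi <=
  expR (2 * t ^+ 2) * expR (t * noise s xi).
Proof.
move=> sz n0 th.
set q := step_prob s xi.
have /andP[q0 q1] : 0 <= q <= 1 by apply: step_prob_bounds; rewrite sz.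
apply: (@le_trans _ _ (step_mean n (fun xi' => expR (t * noise s xi) *
   ((1 - t * q + 2 * t ^+ 2) + t * (head None xi' == Some s)%:R)) xi)).
  apply: step_mean_le => v /=; rewrite mulrDr expRD ler_pM2l ?expR_gt0 // -/q.
  set e := _%:R; have e01 : 0 <= e <= 1 by rewrite ler0n /= lern1; case: (v == _).
  case/andP: e01 => e0 e1.
  have eq1 : `|e - q| <= 1 by rewrite ler_norml; apply/andP; split; lra.
  have : `|t * (e - q)| <= 1 / 2.
    rewrite normrM; have := ler_wpM2l (normr_ge0 t) eq1; lra.
  move/expR_le_quadratic/le_trans; apply.
  rewrite exprMn.
  have e2 : (e - q) ^+ 2 <= 1 by rewrite -real_normK ?num_real // expr_le1.
  have := ler_wpM2l (sqr_ge0 t) e2; lra.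
rewrite step_meanZ mulrC ler_pM2r ?expR_gt0 // step_meanD step_mean_cst // step_meanZ.
rewrite step_mean_step_prob // -/q.
have -> : 1 - t * q + 2 * t ^+ 2 + t * q = 1 + 2 * t ^+ 2 by ring.
exact: expR_ge1Dx.
Qed.

Lemma walk_mean_exp_noise m s t : `|t| <= 1 / 2 ->
  walk_mean m (fun xi => expR (t * noise s xi)) <= expR (1 + 2 * t ^+ 2 * m%:R).
Proof.
move=> th; elim: m => [|m IH].
  (* The two initial increments are each at most 1 in absolute value, and [|t| <= 1/2]; this
     accounts for the constant 1 in the exponent. *)
  have base (b : bool * bool) : `|noise s [:: Some b.2; Some b.1]| <= 2.
    rewrite /=.
    have /andP[] : 0 <= step_prob s [:: Some b.1] <= 1 by apply: step_prob_bounds.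
    have -> : step_prob s [::] = 0 by rewrite /step_prob /step_frac /= !mul0r /h1; ring.
    set u := (Some b.1 == _)%:R; set v := (Some b.2 == _)%:R => q0 q1.
    have u1 : 0 <= u <= 1 by rewrite ler0n lern1 /=; case: (Some b.1 == _).
    have v1 : 0 <= v <= 1 by rewrite ler0n lern1 /=; case: (Some b.2 == _).
    by rewrite ler_norml; case/andP: u1 => ? ?; case/andP: v1 => ? ?; apply/andP; split; lra.
  apply: (@le_trans _ _ (walk_mean 0 (fun=> expR 1))).
    apply: ler_sum => b _; rewrite ler_wpM2l // ler_expR.
    apply: le_trans (ler_norm _) _; rewrite normrM.
    by have := ler_pM (normr_ge0 _) (normr_ge0 _) th (base b); lra.
  rewrite /= sumr_const card_prod card_bool mulr0 addr0.
  by rewrite le_eqVlt; apply/orP; left; apply/eqP; rewrite -mulr_natr; field.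
apply: (@le_trans _ _ (walk_mean m (fun xi => expR (2 * t ^+ 2) * expR (t * noise s xi)))).
  by rewrite [leLHS]/=; apply: walk_mean_le => xi sz; exact: step_mean_exp_noise.
rewrite walk_meanZ; have := ler_wpM2l (ltW (expR_gt0 (2 * t ^+ 2))) IH.
move/le_trans; apply; rewrite -expRD ler_expR -[in leRHS]natr1; lra.
Qed.

(** Chernoff's bound with tilt [t = ±1/(2 sqrt n)], the sign being given by [e]. Then
    [2 t^2 m <= 1/2] keeps the exponential moment below [e^2], and the threshold [2 ln n] yields the
    summable factor [n^(-2)]. Solving for the noise gives [4 sqrt n ln n]. *)
Lemma walk_mean_noise_tail m (s : bool) (e : bool) (n := m.+2) :
  walk_mean m (fun xi => (2 * ln n%:R <= (-1) ^+ e / (2 * n%:R `^ (1 / 2)) * noise s xi)%R%:R)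
  <= expR 2 / n%:R ^+ 2.
Proof.
have mn : m%:R <= n%:R :> R by rewrite ler_nat /n; lia.
have n2 : (0 < n)%N by [].
clearbody n; set t := (-1) ^+ e / _.
have n1 : 1 <= n%:R `^ (1 / 2) :> R.
  by rewrite -[leLHS](powRr0 n%:R) ler_powR ?ler1n.
have n0 : 0 < n%:R :> R by rewrite ltr0n.
have d0 : 0 < 2 * n%:R `^ (1 / 2) :> R by rewrite mulr_gt0 // powR_gt0.
have t2 : `|t| <= 1 / 2.
  rewrite /t normrM normrX normrN normr1 expr1n normfV (gtr0_norm d0).
  by rewrite ler_pM2l // lef_pV2 ?posrE //; lra.
have tt : 2 * t ^+ 2 * m%:R <= 1 - 1 / 2.
  have -> : t ^+ 2 = (4 * n%:R)^-1.
    rewrite /t exprMn -exprM mulnC exprM sqrrN expr1n expr1n mul1r exprVn; congr (_^-1).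
    rewrite exprMn -[X in _ * X]powR_mulrn ?powR_ge0 // -powRrM.
    by rewrite (_ : 1 / 2 * _ = 1) ?powRr1 ?ltW //; [ring | field].
  have -> : 2 * (4 * n%:R)^-1 * m%:R = m%:R / (2 * n%:R) :> R by field; rewrite gt_eqF.
  by rewrite ler_pdivrMr ?mulr_gt0 //; lra.
apply: (@le_trans _ _ (walk_mean m (fun xi => expR (- (2 * ln n%:R)) * expR (t * noise s xi)))).
  apply: walk_mean_le => xi _; rewrite -expRD.
  case: (leP (2 * ln n%:R) (t * noise s xi)) => H /=; last exact: expR_ge0.
  rewrite -[leLHS]expR0 ler_expR; lra.
rewrite walk_meanZ.
apply: le_trans (ler_wpM2l (expR_ge0 _) (walk_mean_exp_noise m s t t2)) _.
rewrite mulrC expRN (_ : expR (2 * ln n%:R) = n%:R ^+ 2); last first.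
  by rewrite expRM_natl lnK.
apply: ler_wpM2r; first by rewrite invr_ge0 exprn_ge0 // ltW.
by rewrite ler_expR; lra.
Qed.

End History.

(** * The law of the history *)

Section DiscreteMeasurability.
Context {d : measure_display} {T : measurableType d}.

(** Measurability for maps with countably many values, stated on fibres so that words, booleans and
    pairs need no sigma-algebra of their own. *)
Definition fibers_measurable {C : Type} (f : T -> C) :=
  forall c, measurable [set w | f w = c].

Lemma measurable_fibers_preimage (C : countType) (f : T -> C) (Q : set C) :
  fibers_measurable f -> measurable [set w | Q (f w)].
Proof.
move=> mf.
have -> : [set w | Q (f w)] = \bigcup_(i in [set: nat])
    (if unpickle i is Some c then [set w | f w = c /\ Q c] else set0).
  apply/seteqP; split=> w /=.
    by move=> Qw; exists (pickle (f w)) => //; rewrite pickleK.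
  by move=> [i _]; case: unpickle => [c|//] /= [->].
apply: bigcup_measurable => i _; case: unpickle => [c|]; last exact: measurable0.
have [Qc|nQc] := pselect (Q c).
  by rewrite (_ : [set _ | _] = [set w | f w = c]) //; apply/seteqP; split=> w /=; [case|].
by rewrite (_ : [set _ | _] = set0); [exact: measurable0 | apply/seteqP; split=> w //= []].
Qed.

Lemma fibers_measurable_comp (C : countType) (D : Type) (h : C -> D) (f : T -> C) :
  fibers_measurable f -> fibers_measurable (fun w => h (f w)).
Proof. by move=> mf c; exact: (measurable_fibers_preimage C f [set x | h x = c] mf). Qed.

Lemma fibers_measurable_pair (C D : Type) (f : T -> C) (g : T -> D) :
  fibers_measurable f -> fibers_measurable g -> fibers_measurable (fun w => (f w, g w)).
Proof.
move=> mf mg [a b].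
rewrite (_ : [set _ | _] = [set w | f w = a] `&` [set w | g w = b]).
  exact: measurableI.
by apply/seteqP; split=> w /=; [case=> -> -> | case=> -> ->].
Qed.

Lemma fibers_measurable_eq1 (R : realType) (f : T -> R) :
  measurable_fun setT f -> fibers_measurable (fun w => f w == 1).
Proof.
move=> mf b; have m1 : measurable (f @^-1` [set 1]) by rewrite -[X in measurable X]setTI; exact: mf.
case: b.
  by rewrite (_ : [set _ | _] = f @^-1` [set 1]) //; apply/seteqP; split=> w /= => [/eqP|->]; rewrite ?eqxx.
rewrite (_ : [set _ | _] = ~` (f @^-1` [set 1])); first exact: measurableC.
by apply/seteqP; split=> w /= => [/negbT/eqP|/eqP/negbTE].
Qed.

End DiscreteMeasurability.

Section FiniteProbability.
Context {d : measure_display} {T : measurableType d} {R : realType} (P : probability T R).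

Lemma Pr_EFin E : measurable E -> P E = (Pr P E)%:E.
Proof. by move=> mE; rewrite /Pr fineK // fin_num_measure. Qed.

Lemma Pr_ge0 E : 0 <= Pr P E.
Proof. by rewrite /Pr fine_ge0. Qed.

Lemma Pr_le E F : measurable E -> measurable F -> E `<=` F -> Pr P E <= Pr P F.
Proof.
by move=> mE mF EF; rewrite -lee_fin -!Pr_EFin //; apply: le_measure => //; rewrite inE.
Qed.

Lemma Pr_setU E F : measurable E -> measurable F -> Pr P (E `|` F) <= Pr P E + Pr P F.
Proof.
move=> mE mF; rewrite -lee_fin EFinD -!Pr_EFin //; last exact: measurableU.
exact: measureU2.
Qed.

(** A finite union bound with a null exceptional set, by removing from [E] one covering set at a
    time. *)
Lemma Pr_cover (I : eqType) (r : seq I) (F : I -> set T) (E N : set T) :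
  measurable E -> (forall i, measurable (F i)) -> measurable N -> Pr P N = 0 ->
  (forall w, E w -> ~ N w -> exists2 i, i \in r & F i w) ->
  Pr P E <= \sum_(i <- r) Pr P (F i).
Proof.
move=> mE mF mN N0; elim: r E mE => [|i r IH] E mE cov.
  rewrite big_nil -N0; apply: Pr_le => // w Ew.
  by apply: contrapT => nN; have [] := cov w Ew nN.
rewrite big_cons.
have mEF : measurable (E `\` F i) by exact: measurableD.
apply: (@le_trans _ _ (Pr P (F i) + Pr P (E `\` F i))).
  apply: le_trans (Pr_setU _ _ (mF i) mEF); apply: Pr_le => //.
    exact: measurableU.
  by move=> w Ew; have [Fw|nFw] := pselect (F i w); [left | right].
rewrite lerD2l; apply: IH => // w [Ew nFw] nN.
have [j] := cov w Ew nN; rewrite inE => /orP[/eqP -> //|jr Fj]; by exists j.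
Qed.

(** [is_unif] prescribes only the masses of the [n] points; these add up to 1, so nothing is left
    outside. *)
Lemma is_unif_range (n : nat) (V : T -> nat) : (0 < n)%N -> is_unif P n V ->
  measurable [set w | ~~ (1 <= V w <= n)%N] /\ Pr P [set w | ~~ (1 <= V w <= n)%N] = 0.
Proof.
move=> n0 [mV uV].
have mS : measurable [set w | (1 <= V w <= n)%N].
  exact: (measurable_fibers_preimage _ V [set j | (1 <= j <= n)%N]).
have E : [set w | ~~ (1 <= V w <= n)%N] = ~` [set w | (1 <= V w <= n)%N].
  by apply/seteqP; split=> w /= /negP.
split; first by rewrite E; exact: measurableC.
rewrite E /Pr probability_setC // (_ : P _ = 1%E) ?subee //.
have -> : [set w | (1 <= V w <= n)%N] = \big[setU/set0]_(i < n) (V @^-1` [set i.+1]).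
  rewrite -(bigcup_mkord n (fun i => V @^-1` [set i.+1])); apply/seteqP; split=> w /=.
    move=> /andP[V1 Vn].
    by exists (V w).-1; rewrite /= prednK.
  by move=> [i] /= ni ->.
rewrite measure_bigsetU_ord //.
  rewrite (eq_bigr (fun=> (n%:R^-1)%:E)); last by move=> i _; apply: uV; rewrite /= ltn_ord.
  rewrite sumEFin sumr_const card_ord -[X in X%:E]mulr_natr mulVf // pnatr_eq0 -lt0n //.
move=> i j _ _ [w [/= Vi Vj]]; apply/val_inj; move: Vi; rewrite Vj => -[] //.
Qed.

End FiniteProbability.

Section WalkLaw.
Context {d : measure_display} {T : measurableType d} {R : realType}.
Variables (P : probability T R) (p : R) (X : nat -> T -> R).
Variables (U : 'I_2 -> nat -> T -> nat) (A : 'I_2 -> nat -> T -> R).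

Let i1 : 'I_2 := lift ord0 ord0.

(** [k] is the length of the history already built, so the result codes step [k+1], and time [U]
    sits at position [k - U]. Signs are read by the test [== 1], so any other value counts as [-1];
    this is faithful off a null set. *)
Definition next_step (k : nat) (w : T) (xi : seq (option bool)) : option bool :=
  match k with
  | 0 => Some (X 1%N w == 1)
  | 1 => Some (X 2%N w == 1)
  | _ => clip_add (sign_act (A ord0 k.+1 w == 1) (nth None xi (k - U ord0 k.+1 w)))
                  (sign_act (A i1 k.+1 w == 1) (nth None xi (k - U i1 k.+1 w)))
  end.

(* A version of the history that is measurable everywhere; [X] itself is only
   determined by the draws outside a null set. *)
Fixpoint history (k : nat) (w : T) : seq (option bool) :=
  if k is k'.+1 then next_step k' w (history k' w) :: history k' w else [::].

Lemma size_history k w : size (history k w) = k.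
Proof. by elim: k => //= k ->. Qed.

(** For [false] the complement is taken rather than the point [-1], so that the two events partition
    the line in agreement with the test [== 1]. *)
Definition sign_event (b : bool) : set R := if b then [set 1] else ~` [set 1].

Lemma sign_eventP b x : sign_event b x <-> (x == 1) = b.
Proof.
case: b => /=; first by split=> [->|/eqP//]; rewrite eqxx.
by split=> [/eqP/negbTE|/negbT/eqP].
Qed.

Lemma measurable_sign_event b : measurable (sign_event b).
Proof. by case: b; [|apply: measurableC]; exact: measurable_set1. Qed.

Lemma Pr_sign_event (q : R) (Y : T -> R) b : is_Rad P q Y ->
  Pr P (Y @^-1` sign_event b) = rad_weight R q b.
Proof.
move=> [mY [Y1 _]].
have m1 : measurable (Y @^-1` [set 1]) by rewrite -[X in measurable X]setTI; exact: mY.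
case: b; rewrite /Pr /rad_weight /=; first by rewrite Y1.
by rewrite -preimage_setC probability_setC // Y1.
Qed.

Hypothesis walk : two_channel_walk P p X U A.
Hypothesis p01 : 0 < p < 1.

Let mX1 : measurable_fun setT (X 1%N). Proof. by case: walk => -[[]]. Qed.
Let mX2 : measurable_fun setT (X 2%N). Proof. by case: walk => -[_ []]. Qed.
Let mU i n : (2 <= n)%N -> fibers_measurable (U i n.+1).
Proof. by move=> n2 c; case: walk => _ /(_ i n n2)[mU _] _ _ _; exact: mU. Qed.
Let mA i n : (2 <= n)%N -> measurable_fun setT (A i n.+1).
Proof. by move=> n2; case: walk => _ _ /(_ i n n2)[]. Qed.

Lemma fibers_measurable_history k : fibers_measurable (history k).
Proof.
elim: k => [|k IH] /=.
  by move=> c; have [->|nc] := pselect (c = [::]);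
    [rewrite (_ : [set _ | _] = setT) // | rewrite (_ : [set _ | _] = set0) //];
    apply/seteqP; split=> w //= /esym.
have mXk (Y : T -> R) : measurable_fun setT Y -> fibers_measurable (fun w => Some (Y w == 1) :: history k w).
  move=> mY; apply: (fibers_measurable_comp _ _ (fun x => Some x.1 :: x.2)
    (fun w => (Y w == 1, history k w))).
  by apply: fibers_measurable_pair => //; exact: fibers_measurable_eq1.
case: k IH mXk => [|[|k]] IH mXk; [exact: mXk|exact: mXk|].
apply: (fibers_measurable_comp _ _
  (fun x : (((bool * bool) * (nat * nat)) * seq (option bool)) =>
     clip_add (sign_act x.1.1.1 (nth None x.2 (k.+2 - x.1.2.1)))
              (sign_act x.1.1.2 (nth None x.2 (k.+2 - x.1.2.2))) :: x.2)
  (fun w => (((A ord0 k.+3 w == 1, A i1 k.+3 w == 1), (U ord0 k.+3 w, U i1 k.+3 w)),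
     history k.+2 w))).
apply: fibers_measurable_pair => //; apply: fibers_measurable_pair;
  apply: fibers_measurable_pair; by [apply/fibers_measurable_eq1/mA | exact: mU].
Qed.

Lemma measurable_history k (Q : set (seq (option bool))) : measurable [set w | Q (history k w)].
Proof. exact: measurable_fibers_preimage (fibers_measurable_history k). Qed.

Definition draws_in (n N : nat) (BU : 'I_2 -> nat -> set nat) (BA : 'I_2 -> nat -> set R) : set T :=
  \bigcap_(k in [set k | (n < k <= N)%N])
    \bigcap_(i in [set: 'I_2]) (U i k @^-1` BU i k `&` A i k @^-1` BA i k).

Definition draws_prob (n N : nat) (BU : 'I_2 -> nat -> set nat) (BA : 'I_2 -> nat -> set R) : R :=
  \prod_(n.+1 <= k < N.+1) \prod_(i < 2)
    (Pr P (U i k @^-1` BU i k) * Pr P (A i k @^-1` BA i k)).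

Lemma measurable_draws_in n N BU BA : (2 <= n)%N -> (forall i k, measurable (BA i k)) ->
  measurable (draws_in n N BU BA).
Proof.
move=> n2 mBA; apply: bigcap_measurableType => -[//|k] /= /andP[nk _].
have k2 : (2 <= k)%N by exact: leq_trans n2 nk.
apply: fin_bigcap_measurable => // i _; apply: measurableI.
  exact: (measurable_fibers_preimage _ _ (BU i k.+1) (mU i k k2)).
by rewrite -[X in measurable X]setTI; apply: mA.
Qed.

(** The event on later draws is what makes the induction on the history close. Each step trades the
    condition on the latest step for a finite union over the values of its four draws, which join
    the later ones. When only the two initial steps remain, [family_indep] factors everything. A
    union bound gives the inequality. *)
Lemma Pr_history_draws_le m N (Q : pred (seq (option bool))) BU BA :
  (m.+2 <= N)%N -> (forall i k, measurable (BA i k)) ->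
  Pr P ([set w | Q (history m.+2 w)] `&` draws_in m.+2 N BU BA) <=
  walk_mean R p m (fun xi => (Q xi)%:R) * draws_prob m.+2 N BU BA.
Proof.
elim: m N Q BU BA => [|m IH] N Q BU BA mN mBA.
  have mD := measurable_draws_in 2 N BU BA isT mBA.
  have mXB (Y : T -> R) b : measurable_fun setT Y -> measurable (Y @^-1` sign_event b).
    by move=> mY; rewrite -[X in measurable X]setTI; apply: mY => //; exact: measurable_sign_event.
  pose F (b : bool * bool) := if Q [:: Some b.2; Some b.1] then
    X 1%N @^-1` sign_event b.1 `&` X 2%N @^-1` sign_event b.2 `&` draws_in 2 N BU BA else set0.
  apply: (@le_trans _ _ (\sum_(b : bool * bool) Pr P (F b))).
    apply: (Pr_cover _ _ _ F _ set0) => //.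
    - by apply: measurableI => //; exact: (measurable_history 2 [set xi | Q xi]).
    - move=> b; rewrite /F; case: ifP => _; last exact: measurable0.
      by apply: measurableI => //; apply: measurableI; exact: mXB.
    - by rewrite /Pr measure0.
    - move=> w [/= Qw Dw] _; exists (X 1%N w == 1, X 2%N w == 1); first by rewrite mem_index_enum.
      by rewrite /F Qw; split => //; split; apply/sign_eventP.
  rewrite big_distrl /=; apply: ler_sum => b _; rewrite /F; case: ifP => Qb; last first.
    by rewrite /Pr measure0 /= mulr0 mul0r.
  case: walk => -[R1 R2] _ _ fi _.
  rewrite (fi N _ _ BU BA) //; try exact: measurable_sign_event.
  rewrite (Pr_sign_event _ _ _ R1) (Pr_sign_event _ _ _ R2) /draws_prob mulr1.
  have r2 c : rad_weight R (1 / 2) c = 1 / 2 by case: c; rewrite /rad_weight //; field.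
  by rewrite !r2 (_ : 1 / 2 * (1 / 2) = 1 / 4) //; field.
set n := m.+2 in IH *.
have n2 : (2 <= n)%N by [].
case: (walk) => _ uni radA _ _.
have [mN0 N00] := is_unif_range P n _ (ltnW n2) (uni ord0 n n2).
have [mN1 N10] := is_unif_range P n _ (ltnW n2) (uni i1 n n2).
pose sel (x y : 'I_n * bool) (i : 'I_2) := if i == ord0 then x else y.
(* The constraints at time [n+1] are overwritten by the chosen draws. Nothing is lost, because
   [draws_in n.+1 N] only constrains later times. *)
pose BU' (x y : 'I_n * bool) i k : set nat :=
  if k == n.+1 then [set (n - (sel x y i).1)%N] else BU i k.
pose BA' (x y : 'I_n * bool) i k : set R :=
  if k == n.+1 then sign_event (sel x y i).2 else BA i k.
have mBA' x y i k : measurable (BA' x y i k).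
  by rewrite /BA'; case: ifP => _ //; exact: measurable_sign_event.
pose Q' x y xi := Q (draw n xi x y :: xi).
pose F (z : ('I_n * bool) * ('I_n * bool)) :=
  [set w | Q' z.1 z.2 (history n w)] `&` draws_in n N (BU' z.1 z.2) (BA' z.1 z.2).
have mF z : measurable (F z).
  by apply: measurableI; [exact: (measurable_history n [set xi | Q' z.1 z.2 xi]) | exact: measurable_draws_in].
apply: (@le_trans _ _ (\sum_z Pr P (F z))).
  (* The exceptional set consists of memory indices outside [1..n], which no position in ['I_n] can
     represent. *)
  apply: (Pr_cover _ _ _ F _ ([set w | ~~ (1 <= U ord0 n.+1 w <= n)%N] `|`
     [set w | ~~ (1 <= U i1 n.+1 w <= n)%N])) => //.
  - by apply: measurableI; [exact: (measurable_history n.+1 [set xi | Q xi]) | exact: measurable_draws_in].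
  - exact: measurableU.
  - apply/eqP; rewrite eq_le Pr_ge0 andbT.
    by have := Pr_setU P _ _ mN0 mN1; rewrite N00 N10 addr0.
  move=> w [Qw Dw] /not_orP[/negP/negPn U0 /negP/negPn U1].
  have lt i : (1 <= U i n.+1 w <= n)%N -> (n - U i n.+1 w < n)%N by move=> /andP[? ?]; lia.
  exists ((Ordinal (lt ord0 U0), A ord0 n.+1 w == 1), (Ordinal (lt i1 U1), A i1 n.+1 w == 1)).
    by rewrite mem_index_enum.
  split; first exact: Qw.
  move=> k /= /andP[nk kN] i _; rewrite /BU' /BA'; case: eqP => [->|kn]; last first.
    by apply: (Dw k _ i) => //=; lia.
  have : i = ord0 \/ i = i1.
    by case: i => [[|[|//]]] Hi; [left | right]; exact/val_inj.
  case=> ->; rewrite /sel /=; split; try exact/sign_eventP; rewrite /= subKn //.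
  - by case/andP: U0.
  - by case/andP: U1.
have prodE x y : draws_prob n N (BU' x y) (BA' x y) =
    (n%:R^-1 * rad_weight R p x.2) * (n%:R^-1 * rad_weight R p y.2) * draws_prob n.+1 N BU BA.
  rewrite /draws_prob big_ltn //; congr (_ * _); last first.
    by apply: eq_big_nat => k /andP[nk _]; apply: eq_bigr => i _; rewrite /BU' /BA' gtn_eqF.
  rewrite !big_ord_recl big_ord0 mulr1 /BU' /BA' eqxx /sel /= -/i1.
  have uE i (j : 'I_n) : Pr P (U i n.+1 @^-1` [set (n - j)%N]) = n%:R^-1.
    case: (uni i n n2) => _ /(_ (n - j)%N) uU; rewrite /Pr uU //=.
    by have := ltn_ord j; lia.
  by rewrite !uE !(Pr_sign_event _ _ _ (radA _ n n2)).
rewrite [walk_mean _ _ _ _]/= -/n.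
have -> : step_mean R p n (fun xi => (Q xi)%:R) = (fun xi => \sum_(z : ('I_n * bool) * ('I_n * bool))
   (n%:R^-1 * rad_weight R p z.1.2) * (n%:R^-1 * rad_weight R p z.2.2) * (Q' z.1 z.2 xi)%:R).
  by apply/funext => xi; rewrite /step_mean pair_big.
rewrite walk_mean_sum big_distrl /=; apply: ler_sum => z _.
apply: le_trans (IH N (Q' z.1 z.2) _ _ (ltnW mN) (mBA' z.1 z.2)) _.
rewrite prodE walk_meanZ le_eqVlt; apply/orP; left; apply/eqP; ring.
Qed.

Lemma Pr_history_le m (Q : pred (seq (option bool))) :
  Pr P [set w | Q (history m.+2 w)] <= walk_mean R p m (fun xi => (Q xi)%:R).
Proof.
have := Pr_history_draws_le m m.+2 Q (fun _ _ => setT) (fun _ _ => setT) (leqnn _)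
  (fun _ _ => measurableT).
rewrite /draws_prob big_geq // mulr1 (_ : draws_in _ _ _ _ = setT) ?setIT //.
by apply/seteqP; split=> w // _ k /= /andP[? ?]; lia.
Qed.

End WalkLaw.

(** * Almost sure bounds and measurability *)

Lemma step_val_eq (R : realType) (s : bool) (v : option bool) :
  (step_val R v == step_val R (Some s)) = (v == Some s).
Proof.
have n1 : (1 == -1 :> R) = false by apply/eqP; lra.
have n2 : (0 == -1 :> R) = false by apply/eqP; lra.
have n3 : (-1 == 1 :> R) = false by apply/eqP; lra.
by case: v => [[]|]; case: s; rewrite /= ?eqxx ?n1 ?n2 ?n3 // eq_sym oner_eq0.
Qed.

Section WalkHistory.
Context {d : measure_display} {T : measurableType d} {R : realType}.
Variables (P : probability T R) (p : R) (X : nat -> T -> R).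
Variables (U : 'I_2 -> nat -> T -> nat) (A : 'I_2 -> nat -> T -> R).
Hypothesis walk : two_channel_walk P p X U A.
Hypothesis p01 : 0 < p < 1.

Let i1 : 'I_2 := lift ord0 ord0.

Let hist := history X U A.

Lemma is_Rad_ae (q : R) (Y : T -> R) : is_Rad P q Y ->
  {ae P, forall w, Y w = step_val R (Some (Y w == 1))}.
Proof.
have ne1 : (1 : R) <> -1 by lra.
move=> [mY [Y1 YN1]].
have m1 : measurable (Y @^-1` [set 1]) by rewrite -[X in measurable X]setTI; exact: mY.
have mN1 : measurable (Y @^-1` [set -1]) by rewrite -[X in measurable X]setTI; exact: mY.
exists (~` (Y @^-1` [set 1] `|` Y @^-1` [set -1])); split.
- by apply: measurableC; exact: measurableU.
- have dY : Y @^-1` [set 1] `&` Y @^-1` [set -1] = set0.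
    by apply/seteqP; split=> w //= [/= ->].
  rewrite probability_setC; last exact: measurableU.
  rewrite (_ : P _ = 1%E) ?subee // measureU //.
  transitivity (q%:E + (1 - q)%:E)%E; first exact: (congr2 _ Y1 YN1).
  by rewrite -EFinD addrC subrK.
- move=> w /= H [] Yw; apply: H; rewrite Yw /=; first by rewrite eqxx.
  by case: eqP => // /esym.
Qed.

(** The event, of full measure, on which the coded history reproduces [X]; all later arguments are
    pathwise on it. *)
Definition regular_draws (w : T) :=
  [/\ X 1%N w = step_val R (Some (X 1%N w == 1)), X 2%N w = step_val R (Some (X 2%N w == 1)) &
      forall i n, (2 <= n)%N -> (1 <= U i n.+1 w <= n)%N /\
        A i n.+1 w = step_val R (Some (A i n.+1 w == 1))].

Lemma regular_draws_ae : {ae P, forall w, regular_draws w}.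
Proof.
case: (walk) => -[R1 R2] uni radA _ _.
have Hi (i : 'I_2) : {ae P, forall w, forall n, (2 <= n)%N -> (1 <= U i n.+1 w <= n)%N /\
        A i n.+1 w = step_val R (Some (A i n.+1 w == 1))}.
  apply: ae_foralln => n; have [n2|n2] := boolP (2 <= n)%N; last by apply: aeW => w.
  have [mN N0] := is_unif_range P n _ (ltnW n2) (uni i n n2).
  have unif_ae : {ae P, forall w, (1 <= U i n.+1 w <= n)%N}.
    exists [set w | ~~ (1 <= U i n.+1 w <= n)%N]; split => //.
      by rewrite (Pr_EFin P) // N0.
    by move=> w /= /negP.
  by apply: filterS2 unif_ae (is_Rad_ae _ _ (radA i n n2)) => w ? ?.
have H1 := is_Rad_ae _ _ R1.
have H2 := is_Rad_ae _ _ R2.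
have H3 := Hi ord0.
have H4 := Hi i1.
near=> w; split; [by near: w | by near: w |].
have h3 : forall n, (2 <= n)%N -> (1 <= U ord0 n.+1 w <= n)%N /\
  A ord0 n.+1 w = step_val R (Some (A ord0 n.+1 w == 1)) by near: w.
have h4 : forall n, (2 <= n)%N -> (1 <= U i1 n.+1 w <= n)%N /\
  A i1 n.+1 w = step_val R (Some (A i1 n.+1 w == 1)) by near: w.
move=> i n n2.
have [->|->] : i = ord0 \/ i = i1.
  by case: i => [[|[|//]]] Hk; [left | right]; exact/val_inj.
- exact: h3.
- exact: h4.
Unshelve. all: by end_near.
Qed.

Lemma step_history n w : regular_draws w -> X n.+1 w = step_val R (next_step X U A n w (hist n w)).
Proof.
move=> [rX1 rX2 rUA].
elim/ltn_ind: n => n IH.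
(* A remembered time [j] is found at position [m - j] of the history of length [m]. Memory reaches
   arbitrarily far back, hence the strong induction. *)
have look m j : (m <= n)%N -> (1 <= j <= m)%N -> X j w = step_val R (nth None (hist m w) (m - j)).
  elim: m => [|m IHm] mn /andP[j1 jm]; first by lia.
  have [jE|jne] := eqVneq j m.+1; first by rewrite jE subnn /= IH.
  have jm' : (j <= m)%N by rewrite -ltnS ltn_neqAle jne.
  by rewrite subSn //= IHm // ?j1 // ltnW.
case: n IH look => [|[|n]] IH look //.
case: walk => _ _ _ _ rec; rewrite rec // -/i1.
have [/(look _ _ (leqnn _)) -> eA0] := rUA ord0 n.+2 isT.
have [/(look _ _ (leqnn _)) -> eA1] := rUA i1 n.+2 isT.
by rewrite eA0 eA1 step_val_clip.
Qed.

Lemma Splus_history n w : regular_draws w ->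
  Splus (fun k => X k w) n = (count_mem (Some true) (hist n w))%:R.
Proof.
move=> rw; elim: n => [|n IH]; first by rewrite /Splus big_geq.
rewrite /Splus big_nat_recr //= -/(Splus _ n) IH natrD addrC step_history //.
by rewrite -(step_val_eq R true).
Qed.

Lemma Sminus_history n w : regular_draws w ->
  Sminus (fun k => X k w) n = (count_mem (Some false) (hist n w))%:R.
Proof.
move=> rw; elim: n => [|n IH]; first by rewrite /Sminus big_geq.
rewrite /Sminus big_nat_recr //= -/(Sminus _ n) IH natrD addrC step_history //.
by rewrite -(step_val_eq R false).
Qed.

Lemma step_frac_history n s w : n%:R * step_frac R s (hist n w) = (count_mem (Some s) (hist n w))%:R.
Proof.
rewrite /step_frac size_history; case: n => [|n]; first by rewrite mul0r.
by rewrite mulrC mulfVK // pnatr_eq0.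
Qed.

Lemma noise_history n s w : (count_mem (Some s) (hist n w))%:R =
  \sum_(0 <= k < n) step_prob R p s (hist k w) + noise R p s (hist n w).
Proof.
elim: n => [|n IH]; first by rewrite big_geq //= addr0.
by rewrite big_nat_recr //= natrD IH; ring.
Qed.

Lemma measurable_fun_history n (f : seq (option bool) -> R) :
  measurable_fun setT (fun w => f (hist n w)).
Proof.
move=> _ B mB; rewrite setTI.
exact: (measurable_history P p X U A walk n [set xi | B (f xi)]).
Qed.

Lemma noise_tail_ae (s e : bool) : {ae P, forall w, \forall n \near \oo,
  (-1) ^+ e / (2 * n%:R `^ (1 / 2)) * noise R p s (hist n w) <= 2 * ln n%:R}.
Proof.
pose Q n (xi : seq (option bool)) : bool := 
  (2 * ln n%:R <= (-1) ^+ e / (2 * n%:R `^ (1 / 2)) * noise R p s xi)%R.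
pose E m := [set w | Q m.+2 (hist m.+2 w)].
have mE m : measurable (E m) := measurable_history P p X U A walk m.+2 [set xi | Q m.+2 xi].
have PE m : (P (E m) <= (expR 2 / m.+2%:R ^+ 2)%:E)%E.
  rewrite (Pr_EFin P) // lee_fin.
  apply: le_trans (Pr_history_le P p X U A walk p01 m (Q m.+2)) _.
  exact: (walk_mean_noise_tail R p p01 m s e).
have sumE : (\sum_(m <oo) P (E m) < +oo)%E.
  apply: (@le_lt_trans _ _ (expR 2)%:E); last exact: ltry.
  apply: lime_le; first by apply: is_cvg_nneseries.
  apply: nearW => n.
  (* The tails [e^2/(m+2)^2] are compared with [e^2 (1/(m+1) - 1/(m+2))], whose sum telescopes to at
     most [e^2]; Borel-Cantelli then applies. *)
  apply: (@le_trans _ _ (\sum_(0 <= m < n) (expR 2 * (m.+1%:R^-1 - m.+2%:R^-1))%:E)%E).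
    apply: lee_sum => m _; apply: le_trans (PE m) _.
    rewrite lee_fin ler_pM2l ?expR_gt0 //.
    have h1 : 0 < m.+1%:R :> R by rewrite ltr0n.
    have h2 : 0 < m.+2%:R :> R by rewrite ltr0n.
    have -> : m.+1%:R^-1 - m.+2%:R^-1 = (m.+1%:R * m.+2%:R)^-1 :> R.
      by move: h1 h2; rewrite -(natr1 m.+1) => h1 h2; field; rewrite !gt_eqF.
    rewrite lef_pV2 ?posrE ?mulr_gt0 ?exprn_gt0 // expr2 ler_pM2r //.
    by rewrite ler_nat.
  rewrite sumEFin lee_fin -big_distrr /= -[leRHS]mulr1 ler_pM2l ?expR_gt0 //.
  rewrite (telescope_sumr_eq (fun m => - m.+1%:R^-1)) //; last by move=> k _; ring.
  by rewrite invr1 opprK addrC gerBl.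
exists (lim_sup_set E); split.
- by apply: bigcapT_measurable => k; apply: bigcup_measurable => j _; exact: mE.
- exact: lim_sup_set_cvg0.
move=> w /= nw k _; apply: contrapT => nEk; apply: nw.
exists k.+2 => // n /= kn.
have nE : n = (n - 2).+2 by lia.
rewrite nE; apply/ltW; rewrite ltNge; apply/negP => Qn; apply: nEk.
by exists (n - 2)%N => //=; lia.
Qed.

Lemma noise_bound_ae s : {ae P, forall w, \forall n \near \oo,
  `|noise R p s (hist n w)| <= 4 * (n%:R `^ (1 / 2) * ln n%:R)}.
Proof.
apply: filterS2 (noise_tail_ae s false) (noise_tail_ae s true) => w H0 H1.
near=> n.
have n0 : (0 < n)%N by near: n; exists 1%N.
have r0 : 0 < n%:R `^ (1 / 2) :> R by apply: powR_gt0; rewrite ltr0n.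
have : (-1) ^+ false / (2 * n%:R `^ (1 / 2)) * noise R p s (hist n w) <= 2 * ln n%:R by near: n.
have : (-1) ^+ true / (2 * n%:R `^ (1 / 2)) * noise R p s (hist n w) <= 2 * ln n%:R by near: n.
move: (n%:R `^ (1 / 2)) r0 => r r0.
rewrite expr1 expr0 -!mulrA ![_^-1 * _]mulrC !mulrA mulN1r mul1r.
rewrite !ler_pdivrMr ?mulr_gt0 // => K1 K0.
rewrite ler_norml; apply/andP; split; lra.
Unshelve. all: by end_near.
Qed.

End WalkHistory.

Section Measurability.
Context {d : measure_display} {T : measurableType d} {R : realType}.

(** The upper limit exists at every point, so it gives a measurable function with no convergence
    assumption, and it agrees with the limit wherever that is finite. *)
Lemma measurable_fine_limn_esup (f : nat -> T -> R) : (forall n, measurable_fun setT (f n)) ->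
  measurable_fun setT (fun w => fine (limn_esup (fun n => (f n w)%:E))).
Proof.
move=> mf.
pose g (w : T) : \bar R := limn_esup (fun n => (f n w)%:E).
have H : measurable_fun setT g.
  apply: (@measurable_fun_limn_esup _ _ R setT (fun n w => (f n w)%:E)) => n.
  exact/measurable_EFinP.
exact: (measurableT_comp (@fine_measurable R setT measurableT) H).
Qed.

Lemma fine_limn_esup_cvg (u : nat -> R) (l : R) : u @ \oo --> l ->
  fine (limn_esup (fun n => (u n)%:E)) = l.
Proof.
move=> ul; have cu : (fun n => (u n)%:E) @ \oo --> l%:E.
  by apply: cvg_EFin => //; apply: nearW.
rewrite is_cvg_limn_esupE; last by apply/cvg_ex; exists l%:E.
by rewrite (cvg_lim _ cu).
Qed.

(** Evaluation of [f] at [g] by a finite case distinction. The result is measurable in [w] even when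
    [f] depends on its second argument in a nonmeasurable way, since only constants are ever
    inserted there. *)
Definition select (r : seq (R * R)) (g : R * R) (f : R * R -> R) : R :=
  foldr (fun c v => if (g.1 == c.1) && (g.2 == c.2) then f c else v) 0 r.

Lemma select_mem r g f : g \in r -> select r g f = f g.
Proof.
elim: r => //= c r IH; rewrite inE => gr.
case: ifP => [/andP[/eqP e1 /eqP e2]|ne]; first by congr f; rewrite (surjective_pairing g) e1 e2 -surjective_pairing.
case/orP: gr => [/eqP gc|]; last exact: IH.
by rewrite gc !eqxx in ne.
Qed.

Lemma measurable_select r (g1 g2 : T -> R) (f : T -> R * R -> R) :
  measurable_fun setT g1 -> measurable_fun setT g2 ->
  (forall c, measurable_fun setT (f ^~ c)) ->
  measurable_fun setT (fun w => select r (g1 w, g2 w) (f w)).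
Proof.
move=> m1 m2 mf; elim: r => [|c r IH] /=; first exact: measurable_cst.
apply: measurable_fun_ifT => //; apply: (@measurable_fun_bool _ _ _ _ true).
rewrite setTI (_ : _ @^-1` _ = g1 @^-1` [set c.1] `&` g2 @^-1` [set c.2]).
  by apply: measurableI; rewrite -[X in measurable X]setTI; [apply: m1 | apply: m2].
by apply/seteqP; split=> w /= => [/andP[/eqP-> /eqP->]|[-> ->]]; rewrite ?eqxx.
Qed.

End Measurability.

(** On the diagonal the equation is [x (3x - 1) = 0]. Off it, [h1 - h2] divided by [x1 - x2] forces
    [x1 + x2 = s], and [h1 + h2] then gives [(x1 - x2)^2 = t^2]. The list may contain pairs that are
    not zeros; it serves as a finite superset. *)
Definition drift_zeros (R : realType) (p : R) : seq (R * R) :=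
  let q := 2 * p - 1 in let s := 2 - q^-1 in
  let t := Num.sqrt ((3 * s ^+ 2 - 2 * s) / q ^+ 2) in
  [:: (0, 0); (1 / 3, 1 / 3); ((s + t) / 2, (s - t) / 2); ((s - t) / 2, (s + t) / 2)].

Lemma drift_zerosP (R : realType) (p x1 x2 : R) :
  h1 p x1 x2 = 0 -> h2 p x1 x2 = 0 -> (x1, x2) \in drift_zeros R p.
Proof.
rewrite /h1 /h2 => H1 H2.
have [e|ne] := eqVneq x1 x2.
  have : x1 * (3 * x1 - 1) = 0 by rewrite -e in H1; lra.
  move/eqP; rewrite mulf_eq0 => /orP[/eqP x0|/eqP x0].
    by rewrite -e x0 !inE eqxx.
  have x23 : x2 = 1 / 3 by rewrite -e; lra.
  by rewrite e x23 !inE eqxx orbT.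
have d0 : x1 - x2 != 0 by rewrite subr_eq0.
pose q := 2 * p - 1; pose s := x1 + x2.
have qs : q * (2 - s) = 1.
  apply: (mulfI d0); rewrite mulr1 /q /s; lra.
have q0 : q != 0 by apply/eqP => q0; move: qs; rewrite q0 mul0r => /eqP; rewrite eq_sym oner_eq0.
have sE : s = 2 - q^-1 by apply: (mulfI q0); rewrite mulrBr mulfV //; lra.
have dE : (x1 - x2) ^+ 2 = (3 * s ^+ 2 - 2 * s) / q ^+ 2.
  apply: (mulIf (expf_neq0 2 q0)); rewrite mulfVK ?expf_neq0 // /s /q; lra.
rewrite /drift_zeros -/q -sE -dE sqrtr_sqr.
have [ge|lt] := leP 0 (x1 - x2).
  rewrite (ger0_norm ge).
  have -> : (s + (x1 - x2)) / 2 = x1 by rewrite /s; lra.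
  have -> : (s - (x1 - x2)) / 2 = x2 by rewrite /s; lra.
  by rewrite !inE eqxx !orbT.
rewrite (ltr0_norm lt).
have -> : (s + - (x1 - x2)) / 2 = x2 by rewrite /s; lra.
have -> : (s - - (x1 - x2)) / 2 = x1 by rewrite /s; lra.
by rewrite !inE eqxx !orbT.
Qed.

Theorem theorem4p9 (R : realType) (d : measure_display) (T : measurableType d)
  (P : probability T R) (p c1 c2 : R) (X : nat -> T -> R)
  (U : 'I_2 -> nat -> T -> nat) (A : 'I_2 -> nat -> T -> R)
  (G : T -> 'cV[R]_2) :
  0 < p < 1 -> p != 7 / 8 ->
  two_channel_walk P p X U A ->
  (* G is Gamma^(p), the almost sure limit of Gamma_n *)
  {ae P, forall w, forall i : 'I_2,
     (fun n => Gam (fun k => X k w) n i 0) @ \oo --> G w i 0} ->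
  {ae P, forall w, lam2 p (G w) < - (1 / 2) < lam1 p (G w) /\ lam1 p (G w) < 0} ->
  exists L : T -> R, measurable_fun setT L /\
    {ae P, forall w,
      (fun n : nat =>
         ((c1 *: nu1 p (G w) + c2 *: nu2 p (G w))^T
            *m (Gam (fun k => X k w) n - G w)) 0 0
         / (n%:R `^ lam1 p (G w)))
      @ \oo --> L w}.
Proof.
move=> p01 _ walk Gae lae.
pose x1 n w := step_frac R true (history X U A n w).
pose x2 n w := step_frac R false (history X U A n w).
(* The quantity of the theorem with [G w] replaced by a constant point, which makes it a function of
   the finite history and hence measurable. *)
pose psi n w (c : R * R) : R :=
  ((c1 *: nu1 p (vec2 c.1 c.2) + c2 *: nu2 p (vec2 c.1 c.2))^T
     *m (vec2 (x1 n w) (x2 n w) - vec2 c.1 c.2)) 0 0 / n%:R `^ lam1 p (vec2 c.1 c.2).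
(* [g1] and [g2] are measurable versions of the coordinates of [G], almost surely equal to them.
   Almost surely they also form a zero of the drift, so [select] finds them in the list and [F] is
   the sequence of the theorem. *)
pose g1 w : R := fine (limn_esup (fun n => (x1 n w)%:E)).
pose g2 w : R := fine (limn_esup (fun n => (x2 n w)%:E)).
pose F n w := select (drift_zeros R p) (g1 w, g2 w) (psi n w).
exists (fun w => fine (limn_esup (fun n => (F n w)%:E))); split.
  apply: measurable_fine_limn_esup => n; apply: measurable_select.
  - by apply: measurable_fine_limn_esup => k; exact: (measurable_fun_history P p).
  - by apply: measurable_fine_limn_esup => k; exact: (measurable_fun_history P p).
  - move=> c; exact: (measurable_fun_history P p X U A walk n (fun xi =>
      ((c1 *: nu1 p (vec2 c.1 c.2) + c2 *: nu2 p (vec2 c.1 c.2))^T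
       *m (vec2 (step_frac R true xi) (step_frac R false xi) - vec2 c.1 c.2)) 0 0 /
       n%:R `^ lam1 p (vec2 c.1 c.2))).
have reg := regular_draws_ae P p X U A walk.
have noise1 := noise_bound_ae P p X U A walk p01 true.
have noise2 := noise_bound_ae P p X U A walk p01 false.
near=> w.
have rw : regular_draws X U A w by near: w.
have GamE n : Gam (fun k => X k w) n = vec2 (x1 n w) (x2 n w).
  rewrite /Gam (Splus_history P p X U A walk p01) // (Sminus_history P p X U A walk p01) //.
  by rewrite /x1 /x2 /step_frac size_history.
have Gw : forall i : 'I_2, (fun n => Gam (fun k => X k w) n i 0) @ \oo --> G w i 0 by near: w.
have [/andP[l2 l1] l0] : lam2 p (G w) < - (1 / 2) < lam1 p (G w) /\ lam1 p (G w) < 0 by near: w.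
have M1s : \forall n \near \oo, `|noise R p true (history X U A n w)| <=
  4 * (n%:R `^ (1 / 2) * ln n%:R) by near: w.
have M2s : \forall n \near \oo, `|noise R p false (history X U A n w)| <=
  4 * (n%:R `^ (1 / 2) * ln n%:R) by near: w.
have x1g : (x1 ^~ w) @ \oo --> G w 0 0.
  rewrite (_ : x1 ^~ w = (fun n => Gam (fun k => X k w) n 0 0)); first exact: Gw.
  by apply/funext => n; rewrite GamE mxE.
have x2g : (x2 ^~ w) @ \oo --> G w 1 0.
  rewrite (_ : x2 ^~ w = (fun n => Gam (fun k => X k w) n 1 0)); first exact: Gw.
  by apply/funext => n; rewrite GamE mxE.
have x1E n : n%:R * x1 n w = \sum_(0 <= k < n) (h1 p (x1 k w) (x2 k w) + x1 k w) +
    noise R p true (history X U A n w).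
  by rewrite step_frac_history (noise_history p).
have x2E n : n%:R * x2 n w = \sum_(0 <= k < n) (h2 p (x1 k w) (x2 k w) + x2 k w) +
    noise R p false (history X U A n w).
  rewrite step_frac_history (noise_history p); congr (_ + _); apply: eq_bigr => k _.
  by rewrite /step_prob -/(x1 k w) -/(x2 k w) /h1 /h2; ring.
have [z1 z2] := walk_drift_eq0 _ _ _ _ _ _ _ x1E x2E
  (noise_average_cvg0 _ _ M1s) (noise_average_cvg0 _ _ M2s) x1g x2g.
have GE : G w = vec2 (g1 w) (g2 w).
  rewrite /g1 /g2 (fine_limn_esup_cvg _ _ x1g) (fine_limn_esup_cvg _ _ x2g).
  apply/colP => i; rewrite mxE; case: i => [[|[|//]]] Hi /=.
    by congr (G w _ _); exact/val_inj.
  by congr (G w _ _); exact/val_inj.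
have l12 : lam2 p (G w) < - (1 / 2) < lam1 p (G w) by rewrite l2.
have := walk_path_cvg _ _ _ _ _ _ _ (c1 *: nu1 p (G w) + c2 *: nu2 p (G w))
  p01 x1E x2E M1s M2s x1g x2g l12 l0.
move=> /cvg_ex[l Hl].
have FE : F ^~ w = (fun n => ((c1 *: nu1 p (G w) + c2 *: nu2 p (G w))^T
            *m (Gam (fun k => X k w) n - G w)) 0 0 / (n%:R `^ lam1 p (G w))).
  apply/funext => n; rewrite /F select_mem; first by rewrite /psi /= -GE GamE.
  have := drift_zerosP _ _ _ _ z1 z2; rewrite GE !mxE //.
rewrite -FE; rewrite (_ : fine _ = l).
  by rewrite FE; under eq_fun do rewrite GamE.
apply: fine_limn_esup_cvg; rewrite FE.
by under eq_fun do rewrite GamE.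
Unshelve. all: by end_near.
Qed.
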